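(* Let $n\ge 2$, let $(S_1,\ldots,S_n)$ be a $\Gamma_n$-contraction on a Hilbert space $\mathcal H$ with fundamental operators $E_1,\ldots,E_{n-1}\in\mathcal B(\mathcal D_{S_n})$, and let $\gamma_i=\frac{n-i}{n}$ for $i=1,\ldots,n-1$. Each of the following conditions is necessary for the existence of a $\Gamma_n$-isometric dilation of $(S_1,\ldots,S_n)$ (that is, if $(S_1,\ldots,S_n)$ has a $\Gamma_n$-isometric dilation, then each of the following holds): \begin{enumerate} \item The $(n-1)$-tuple $(\gamma_1E_1,\ldots,\gamma_{n-1}E_{n-1})$ has a joint dilation to a commuting $(n-1)$-tuple of subnormal operators $(\gamma_1\tilde S_1,\ldots,\gamma_{n-1}\tilde S_{n-1})$; that is, there exists an isometry $\Theta$ of $\mathcal D_{S_n}$ into a larger Hilbert space $\tilde{\mathcal H}$ such that $\gamma_iE_i=\Theta^*\gamma_i\tilde S_i\Theta$ for $i=1,\ldots,n-1$, where $(\gamma_1\tilde S_1,\ldots,\gamma_{n-1}\tilde S_{n-1})$ (acting on $\tilde{\mathcal H}$) can be extended to a commuting $(n-1)$-tuple of normal operators $(\gamma_1U_1,\ldots,\gamma_{n-1}U_{n-1})$ whose joint spectrum $\sigma(\gamma_1U_1,\ldots,\gamma_{n-1}U_{n-1})$ lies in $\Gamma_{n-1}$. \item For $i=1,\ldots,n-1$, $(E_i^*D_{S_n}S_i-E_{n-i}^*D_{S_n}S_{n-i})|_{\ker D_{S_n}}=0$. \item For $i=1,\ldots,n-1$, $(E_i^*E_{n-i}^*-E_{n-i}^*E_i^*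 )D_{S_n}S_n|_{\ker D_{S_n}}=0$. \end{enumerate}
   Context: All Hilbert spaces are complex; $\mathcal B(\mathcal H)$ is the algebra of bounded operators on $\mathcal H$. For $m\ge1$ let $\mathbf s:\mathbb C^m\to\mathbb C^m$ be the symmetrization map $\mathbf s(z)=(s_1(z),\ldots,s_m(z))$, $s_i(z)=\sum_{1\le k_1<\cdots<k_i\le m}z_{k_1}\cdots z_{k_i}$. Put $\Gamma_m=\mathbf s(\overline{\mathbb D}^m)$ (closed symmetrized polydisc) and $b\Gamma_m=\mathbf s(\mathbb T^m)$ (its distinguished boundary). A compact set $\Omega\subset\mathbb C^m$ is a spectral set for a commuting $m$-tuple $\mathbf T$ of bounded operators if the joint (Taylor) spectrum $\sigma(\mathbf T)\subseteq\Omega$ and the homomorphism $f\mapsto f(\mathbf T)$ from $\mathcal O(\Omega)$ (functions holomorphic in a neighbourhood of $\Omega$, with the sup norm over $\Omega$) to the bounded operators is contractive. A $\Gamma_m$-contraction is a commuting $m$-tuple of bounded operators having $\Gamma_m$ as a spectral set. A $\Gamma_n$-unitary is a commuting $n$-tuple of normal operators with joint spectrum contained in $b\Gamma_n$. A $\Gamma_n$-isometry is a commuting $n$-tuple on a Hilbert space that is the restriction of a $\Gamma_n$-unitary, acting on a possibly larger Hilbert space, to a common invariant subspace. A $\Gamma_n$-isometric dilation of a $\Gamma_n$-contraction $(S_1,\ldots,S_n)$ on $\mathcal H$ is a $\Gamma_n$-isometry $(V_1,\ldots,V_n)$ on a Hilbert space $\mathcal K\supseteq\mathcal H$ such that $P_{\mathcal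 H}V_1^{m_1}\cdots V_n^{m_n}|_{\mathcal H}=S_1^{m_1}\cdots S_n^{m_n}$ for all integers $m_1,\ldots,m_n\ge0$. For a $\Gamma_n$-contraction, $\|S_n\|\le1$; $D_{S_n}=(I-S_n^*S_n)^{1/2}$ and $\mathcal D_{S_n}=\overline{\operatorname{Ran}}\,D_{S_n}$. The fundamental operators $E_1,\ldots,E_{n-1}\in\mathcal B(\mathcal D_{S_n})$ of $(S_1,\ldots,S_n)$ are the (known to exist and be unique) operators satisfying $S_i-S_{n-i}^*S_n=D_{S_n}E_iD_{S_n}$ for $i=1,\ldots,n-1$. *)

(* Defs.v *)
From HB Require Import structures.
From mathcomp Require Import all_boot all_order all_algebra.
From mathcomp Require Import sesquilinear complex.
From mathcomp Require Import all_classical all_reals all_analysis.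
Import Order.TTheory GRing.Theory Num.Theory.
Import numFieldNormedType.Exports.

Set Implicit Arguments.
Unset Strict Implicit.
Unset Printing Implicit Defensive.

Local Open Scope classical_set_scope.
Local Open Scope ring_scope.

(* The topology of R[i] is given by its norm, the complex modulus, as for any
   numFieldType. *)
HB.instance Definition _ (R : realType) := PseudoPointedMetric.copy R[i] R[i]^o.
HB.instance Definition _ (R : realType) := NormedModule.copy R[i] R[i]^o.

(* The inner product is linear in its first argument and conjugate-linear in
   the second. *)
HB.mixin Record isHilbert (R : realType) H & NormedModule R[i] H := {
  hdot : {dot H for (@Num.conj R[i])};
  hdot_norm : forall x : H, hdot x x = `|x| ^+ 2 }.

#[short(type="hilbertType")]
HB.structure Definition Hilbert (R : realType) :=
  {H of CompleteNormedModule R[i] H & isHilbert R H}.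

(* A linear map is bounded iff it is continuous: linear_bounded_continuous. *)
#[short(type="boundedOp")]
HB.structure Definition BoundedOp (K : numFieldType) (U V : normedModType K) :=
  {f of @GRing.Linear K U V *:%R f & @isContinuous U V f}.

Section ScaledOperator.
Variables (K : numFieldType) (U V : normedModType K) (c : K).
Variable A : boundedOp U V.

Lemma scale_op_continuous : continuous (c \*: A).
Proof. by move=> x; apply: cvgZl_tmp; exact: cts_fun. Qed.

HB.instance Definition _ :=
  @isContinuous.Build U V (c \*: A) scale_op_continuous.

Definition scale_op : boundedOp U V := (c \*: A).

End ScaledOperator.

(* Closed subspaces of a Hilbert space are Hilbert spaces. *)
Record closedSubspace (R : realType) (H : hilbertType R) := ClosedSubspace {
  csub_set :> set H;
  csub_zero : csub_set 0;
  csub_linear : forall (a : R[i]) x y,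
    csub_set x -> csub_set y -> csub_set (a *: x + y);
  csub_closed : closed csub_set }.

Section SubHilbert.
Variables (R : realType) (H : hilbertType R) (M : closedSubspace H).
Local Notation C := R[i].

Record csub := CSub { csub_val : H; csub_valP : csub_val \in (M : set H) }.

HB.instance Definition _ := [isSub for csub_val].
HB.instance Definition _ := [Choice of csub by <:].

Fact csub_submod_closed : submod_closed [pred x | x \in (M : set H)].
Proof.
split=> [|a x y]; rewrite !inE; first exact: csub_zero.
exact: csub_linear.
Qed.

HB.instance Definition _ :=
  GRing.SubChoice_isSubLmodule.Build C H _ csub csub_submod_closed.

Let csub_norm (x : csub) : C := `|csub_val x|.

Let csub_normD x y : csub_norm (x + y) <= csub_norm x + csub_norm y.
Proof. exact: ler_normD. Qed.

Let csub_normZ (l : C) x : csub_norm (l *: x) = `|l| * csub_norm x.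
Proof. exact: normrZ. Qed.

Let csub_norm_eq0 x : csub_norm x = 0 -> x = 0.
Proof. by move=> /eqP; rewrite normr_eq0 => /eqP x0; apply: val_inj. Qed.

HB.instance Definition _ :=
  @Lmodule_isNormed.Build C csub csub_norm csub_normD csub_normZ csub_norm_eq0.

Lemma csub_normE (x : csub) : `|x| = `|csub_val x|.
Proof. by []. Qed.

Let csub_complete (F : set_system csub) : ProperFilter F -> cauchy F -> cvg F.
Proof.
move=> PF /cauchy_ballP cF.
have cG : cauchy (csub_val @ F).
  apply/cauchy_ballP => e e0.
  have := cF e e0.
  rewrite !near_simpl => [[[P Q] /= [FP FQ] PQ]].
  exists (csub_val @` P, csub_val @` Q) => /=.
    by split; [apply: filterS FP|apply: filterS FQ] => x ?; exists x.
  move=> [_ _] /= [[x Px <-] [y Qy <-]].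
  have := PQ (x, y) (conj Px Qy).
  by rewrite -!ball_normE.
have /cauchy_cvg/cvg_ex[l Fl] := cG.
have Ml : (M : set H) l.
  apply: (@closed_cvg _ _ F _ csub_val (M : set H) (@csub_closed _ _ M) _ _ Fl).
  by apply: nearW => x; have := csub_valP x; rewrite inE.
apply/cvg_ex; exists (CSub (mem_set Ml)).
apply/cvgrPdist_lt => e e0.
by move/cvgrPdist_lt: Fl => /(_ e e0).
Qed.

HB.instance Definition _ := Uniform_isComplete.Build csub csub_complete.

Definition csub_dot (x y : csub) : C := hdot (csub_val x) (csub_val y).

Fact csub_dot_bilinear : bilinear_for *%R (@Num.conj C \; *%R) csub_dot.
Proof.
split=> u a x y /=; rewrite /csub_dot /=.
  by rewrite [LHS]linearPl.
by rewrite [LHS]linearPr.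
Qed.

HB.instance Definition _ := @bilinear_isBilinear.Build C csub csub C
  *%R (@Num.conj C \; *%R) csub_dot csub_dot_bilinear.

Fact csub_dot_herm x y : csub_dot x y = (-1) ^+ false * Num.conj (csub_dot y x).
Proof. exact: hermitian_subproof. Qed.

HB.instance Definition _ :=
  @isHermitianSesquilinear.Build C csub false (@Num.conj C) csub_dot csub_dot_herm.

Fact csub_dot_gt0 u : u != 0 -> 0 < csub_dot u u.
Proof. by move=> u0; apply: neq0_dnorm_gt0. Qed.

HB.instance Definition _ := @isDotProduct.Build C csub csub_dot csub_dot_gt0.

Fact csub_dot_norm x : csub_dot x x = `|x| ^+ 2.
Proof. exact: hdot_norm. Qed.

HB.instance Definition _ := @isHilbert.Build R csub csub_dot csub_dot_norm.

End SubHilbert.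

Section RangeClosure.
Variables (R : realType) (H K : hilbertType R) (D : boundedOp H K).

Fact range_closure0 : closure (range D) 0.
Proof. by apply: subset_closure; exists 0 => //; exact: linear0. Qed.

Fact range_closure_linear (a : R[i]) x y : closure (range D) x ->
  closure (range D) y -> closure (range D) (a *: x + y).
Proof.
move=> cx cy B.
have cont : (fun z : K * K => a *: z.1 + z.2) @ (x, y) --> a *: x + y.
  by apply: cvgD; [apply: cvgZl_tmp; exact: cvg_fst|exact: cvg_snd].
move=> /cont [[P Q] /= [Px Qy] PQ].
have [_ [[u _ <-] Pu]] := cx P Px.
have [_ [[v _ <-] Qv]] := cy Q Qy.
exists (D (a *: u + v)); split; first by exists (a *: u + v).
by rewrite linearP; exact: (PQ (D u, D v)).
Qed.

Definition range_closure : closedSubspace K :=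
  ClosedSubspace range_closure0 range_closure_linear (@closed_closure _ _).

Fact range_closure_mem (x : H) : D x \in (range_closure : set K).
Proof. by rewrite inE; apply: subset_closure; exists x. Qed.

(* D with its codomain restricted to the closure of its range. *)
Definition corange (x : H) : csub range_closure := CSub (range_closure_mem x).

End RangeClosure.

Section Operators.
Variable R : realType.
Local Notation C := R[i].

(* A^* y is the unique z with <A x, y> = <x, z> for all x; it exists by the
   Riesz representation theorem, so the default value 0 is never used. *)
Definition adj (H K : hilbertType R) (A : boundedOp H K) (y : K) : H :=
  xget 0 [set z | forall x, hdot (A x) y = hdot x z].

Definition isometric (H K : hilbertType R) (J : boundedOp H K) : Prop :=
  forall x, `|J x| = `|x|.

Definition normal_op (H : hilbertType R) (A : boundedOp H H) : Prop :=
  forall x, A (adj A x) = adj A (A x).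

(* Larger Hilbert spaces are presented by an isometric embedding J. *)
Definition subnormal_op (H : hilbertType R) (A : boundedOp H H) : Prop :=
  exists (K : hilbertType R) (J : boundedOp H K) (N : boundedOp K K),
    [/\ isometric J, normal_op N & forall x, J (A x) = N (J x)].

Definition commuting (H : hilbertType R) n (T : 'I_n -> boundedOp H H) : Prop :=
  forall i j x, T i (T j x) = T j (T i x).

Definition commuting_normal (H : hilbertType R) n (T : 'I_n -> boundedOp H H)
  : Prop := commuting T /\ forall i, normal_op (T i).

(* The operator T_1 ^ k_1 ... T_n ^ k_n. *)
Definition monomial (H : hilbertType R) n (T : 'I_n -> boundedOp H H)
    (k : 'I_n -> nat) : H -> H :=
  \big[(fun f g => f \o g)/id]_(i < n) iter (k i) (T i).

(* D = (I - S^* S)^(1/2), the positive square root. *)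
Definition is_defect (H : hilbertType R) (S D : boundedOp H H) : Prop :=
  (forall x, 0 <= hdot (D x) x) /\ (forall x, D (D x) = x - adj S (S x)).

(** Taylor joint spectrum *)

(* An element of H (x) Lambda(C^n) is a family w of vectors indexed by
   subsets A of {0,...,n-1}, w A being the coefficient of
   s_(a_1) /\ ... /\ s_(a_p) for A = {a_1 < ... < a_p}.  The coboundary is
   w |-> \sum_i T_i w /\ s_i, with s_i put in front. *)
Definition koszul (H : hilbertType R) n (T : 'I_n -> H -> H)
    (w : {set 'I_n} -> H) (A : {set 'I_n}) : H :=
  \sum_(i in A) (-1) ^+ #|[set j in A | (j < i)%N]| *: T i (w (A :\ i)).

Definition koszul_exact (H : hilbertType R) n (T : 'I_n -> H -> H) : Prop :=
  forall w, (forall A, koszul T w A = 0) ->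
  exists v, forall A, koszul T v A = w A.

Definition taylor_spectrum (H : hilbertType R) n (T : 'I_n -> boundedOp H H)
  : set 'rV[C]_n :=
  [set lam | ~ koszul_exact (fun i x => T i x - lam 0 i *: x)].

(** Holomorphic functional calculus and spectral sets *)

Definition holomorphic_on (V : normedModType C) n (U : set 'rV[C]_n)
    (f : 'rV[C]_n -> V) : Prop :=
  forall z, U z -> differentiable f z.

(* A = f(T) for Taylor's functional calculus, f being holomorphic near Omega
   and the joint spectrum of T lying in Omega.  When Omega has a basis of
   Stein neighbourhoods (as the polynomially convex set Gamma n has), constants
   induce an isomorphism
     H ~ O(Omega, H) / \sum_i (z_i - T_i) O(Omega, H),
   and Taylor defines f(T) as the multiplication by f on the right-hand side:
   f(T) x is the y such that f x - y is in \sum_i (z_i - T_i) O(Omega, H). *)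
Definition holomorphic_calculus (H : hilbertType R) n (Omega : set 'rV[C]_n)
    (T : 'I_n -> boundedOp H H) (f : 'rV[C]_n -> C) (A : boundedOp H H) : Prop :=
  forall x, exists (U : set 'rV[C]_n) (g : 'I_n -> 'rV[C]_n -> H),
    [/\ open U, Omega `<=` U, (forall i, holomorphic_on U (g i)) &
        forall z, U z ->
          f z *: x - A x = \sum_(i < n) (z 0 i *: g i z - T i (g i z))].

(* For Omega compact; the norm inequality says |f(T)| <= sup_Omega |f|. *)
Definition spectral_set (H : hilbertType R) n (Omega : set 'rV[C]_n)
    (T : 'I_n -> boundedOp H H) : Prop :=
  taylor_spectrum T `<=` Omega /\
  forall f : 'rV[C]_n -> C,
    (exists U, [/\ open U, Omega `<=` U & holomorphic_on U f]) ->
    exists2 A : boundedOp H H, holomorphic_calculus Omega T f A &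
      forall M : C, (forall z, Omega z -> `|f z| <= M) ->
        forall x, `|A x| <= M * `|x|.

(** The symmetrized polydisc *)

Definition symmetrization n (z : 'rV[C]_n) : 'rV[C]_n :=
  \row_(i < n) \sum_(A : {set 'I_n} | #|A| == i.+1) \prod_(k in A) z 0 k.

Definition Gamma n : set 'rV[C]_n :=
  [set symmetrization z | z in [set z : 'rV[C]_n | forall i, `|z 0 i| <= 1]].

Definition bGamma n : set 'rV[C]_n :=
  [set symmetrization z | z in [set z : 'rV[C]_n | forall i, `|z 0 i| = 1]].

Definition Gamma_contraction (H : hilbertType R) n
    (S : 'I_n -> boundedOp H H) : Prop :=
  commuting S /\ spectral_set (@Gamma n) S.

Definition Gamma_unitary (H : hilbertType R) n (U : 'I_n -> boundedOp H H)
  : Prop := commuting_normal U /\ taylor_spectrum U `<=` @bGamma n.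

Definition Gamma_isometry (H : hilbertType R) n (V : 'I_n -> boundedOp H H)
  : Prop :=
  exists (K : hilbertType R) (J : boundedOp H K) (U : 'I_n -> boundedOp K K),
    [/\ isometric J, Gamma_unitary U & forall i x, J (V i x) = U i (J x)].

(* With J : H -> K the inclusion, P_H is J^*. *)
Definition Gamma_isometric_dilation (H K : hilbertType R) n
    (S : 'I_n -> boundedOp H H) (J : boundedOp H K) (V : 'I_n -> boundedOp K K)
  : Prop :=
  [/\ isometric J, Gamma_isometry V &
      forall k x, adj J (monomial V k (J x)) = monomial S k x].

(** Fundamental operators *)

(* For S = (S_1, ..., S_n) with n = m + 1, the index i : 'I_m stands for
   i + 1 in {1, ..., n - 1}; then rev_ord i stands for n - (i + 1). *)
Definition below_top m (i : 'I_m) : 'I_m.+1 := widen_ord (leqnSn m) i.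

Definition defect_space (H : hilbertType R) (D : boundedOp H H)
  : hilbertType R := csub (range_closure D).

Definition fundamental_operators (H : hilbertType R) m
    (S : 'I_m.+1 -> boundedOp H H) (D : boundedOp H H)
    (E : 'I_m -> boundedOp (defect_space D) (defect_space D)) : Prop :=
  forall (i : 'I_m) x,
    S (below_top i) x - adj (S (below_top (rev_ord i))) (S ord_max x) =
    D (csub_val (E i (corange D x))).

Definition gamma (n i : nat) : C := (n - i)%:R / n%:R.

End Operators.

(* Main.v *)
Require Import Defs.
From HB Require Import structures.
From mathcomp Require Import all_boot all_order all_algebra.
From mathcomp Require Import sesquilinear complex ring lra zify.
From mathcomp Require Import all_classical all_reals all_analysis.
Import Order.TTheory GRing.Theory Num.Theory.
Import numFieldNormedType.Exports.

(** Let J : H -> L be the isometry obtained by composing the inclusion of H in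
    the space of the dilation with the inclusion of the latter in the space of
    a Gamma-unitary U.  Then J^* U^k J = S^k for all multi-indices k.  Write P
    for the projection J J^* and n for the top index.

    U_n is unitary and U_i = U_(n-i)^* U_n, since these relations hold on the
    distinguished boundary.  Hence |D x|^2 = |x|^2 - |S_n x|^2 is the square
    of the norm of (1 - P) U_n J x, so that D x |-> (1 - P) U_n J x extends to
    an isometry Theta of the defect space into L (isometry_extension).  Since
    J^* U_i (1 - P) U_n J = S_i S_n - S_i S_n = 0, expanding shows that
    D Theta^* U_i Theta D = S_i - S_(n-i)^* S_n = D E_i D; D being injective
    on the closure of its range, E_i = Theta^* U_i Theta
    (fundamental_dilation).  The operators gamma_i U_i commute and are
    normal, so they are their own normal extension.  A point of their joint
    spectrum is the image of a point (s_1, ..., s_n) of the joint spectrum of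
    U, that is of the distinguished boundary.  The gamma_i s_i are up to sign
    the coefficients of p'/n, where p has the unimodular roots which s
    symmetrizes; the roots of p' lie in the closed disc by the Gauss-Lucas
    theorem, so the point lies in Gamma_(n-1) (bGamma_derivative,
    Gamma_unitary_scaled_spectrum).

    The other two conditions are consequences of the fundamental equations
    and of the injectivity of D on the closure of its range.  On ker D these
    equations give S_i = S_(n-i)^* S_n, whence
    S_i^* S_i = S_(n-i)^* S_(n-i) there, which is D applied to the second
    condition (adj_fundamental_kernel).  The third one follows from the
    second and from D S_i = E_i D + E_(n-i)^* D S_n (defect_comp).

    What remains is the passage between relations among commuting normal
    operators and their Taylor spectrum.  It goes through joint approximate
    eigenvectors.  Fuglede's theorem (fuglede) makes all adjoints commute.
    The power method turns an approximate eigenvector of a commuting family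
    into one of a larger family (joint_approx_selfadjoint), so every joint
    approximate eigenvalue extends to further operators.  For commuting
    normal operators, the Taylor spectrum is the set of joint approximate
    eigenvalues: exactness of the Koszul complex in top degree excludes them
    by uniform boundedness (approx_taylor_spectrum), and in their absence
    the sum of the (T_i - lam_i)^* (T_i - lam_i) is invertible and yields a
    contracting homotopy of the complex (taylor_spectrum_approx).  If an
    operator B of the commuting family is nonzero then |B|^2 is an
    approximate eigenvalue of B^* B, extends to one of the whole family, and
    so B cannot vanish on the spectrum (vanish_on_spectrum). *)

Set Implicit Arguments.
Unset Strict Implicit.
Unset Printing Implicit Defensive.

Local Open Scope classical_set_scope.
Local Open Scope ring_scope.
Local Open Scope complex_scope.
Local Notation "x ^*" := (Num.conj x) : complex_scope.

(** * Real-valued norms and inner products *)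

Section RealNorm.
Variables (R : realType) (V : normedModType R[i]).
Implicit Types x y : V.

(** Norms over R[i] take values in R[i], whose order is partial; the
    estimates are carried out in R. *)
Definition nrm x : R := complex.Re `|x|.

Lemma nrmE x : `|x| = (nrm x)%:C.
Proof. by rewrite /nrm RRe_real ?normr_real. Qed.

Lemma nrm_ge0 x : 0 <= nrm x.
Proof. by rewrite -lecR -nrmE; exact: normr_ge0. Qed.

Lemma nrmD x y : nrm (x + y) <= nrm x + nrm y.
Proof. by rewrite -lecR rmorphD /= -!nrmE ler_normD. Qed.

Lemma nrmN x : nrm (- x) = nrm x.
Proof. by rewrite /nrm normrN. Qed.

Lemma nrmB x y : nrm (x - y) <= nrm x + nrm y.
Proof. by rewrite -(nrmN y) nrmD. Qed.

Lemma nrmC x y : nrm (x - y) = nrm (y - x).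
Proof. by rewrite -nrmN opprB. Qed.

Lemma nrm0 : nrm (0 : V) = 0.
Proof. by rewrite /nrm normr0. Qed.

Lemma nrm_eq0 x : nrm x = 0 -> x = 0.
Proof. by move=> h; apply/normr0_eq0; rewrite nrmE h. Qed.

Lemma nrm_gt0 x : x != 0 -> 0 < nrm x.
Proof.
move=> x0; rewrite lt_neqAle nrm_ge0 andbT eq_sym.
by apply: contra_neq x0 => /nrm_eq0.
Qed.

Lemma nrm_sum I (r : seq I) (P : pred I) (F : I -> V) :
  nrm (\sum_(i <- r | P i) F i) <= \sum_(i <- r | P i) nrm (F i).
Proof.
elim/big_rec2: _ => [|i y z _ h]; first by rewrite nrm0.
by apply: le_trans (nrmD _ _) _; rewrite lerD2l.
Qed.

End RealNorm.

Lemma nrmZ (R : realType) (V : normedModType R[i]) (a : R[i]) (x : V) :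
  nrm (a *: x) = nrm a * nrm x.
Proof. by apply: complexI; rewrite rmorphM /= -!nrmE normrZ. Qed.

Section ScalarNorm.
Variable R : realType.
Implicit Types a b : R[i].

Lemma nrmM a b : nrm (a * b) = nrm a * nrm b.
Proof. by rewrite -nrmZ. Qed.

Lemma nrm_real (t : R) : nrm (t%:C : R[i]) = `|t|.
Proof.
by rewrite /nrm normc_def /= expr0n addr0 sqrtr_sqr.
Qed.

Lemma nrm_nneg (t : R) : 0 <= t -> nrm (t%:C : R[i]) = t.
Proof. by move=> t0; rewrite nrm_real ger0_norm. Qed.

Lemma nrm1 : nrm (1 : R[i]) = 1.
Proof. by rewrite /nrm normr1. Qed.

Lemma nrm_i : nrm ('i : R[i]) = 1.
Proof. by rewrite /nrm normc_def /= expr0n expr1n add0r sqrtr1. Qed.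

Lemma nrm_conj a : nrm a^* = nrm a.
Proof. by rewrite /nrm normcJ. Qed.

Lemma Re_le_nrm a : `|complex.Re a| <= nrm a.
Proof. by rewrite -lecR -nrmE normc_ge_Re. Qed.

Lemma nrm_exp a k : nrm (a ^+ k) = nrm a ^+ k.
Proof. by elim: k => [|k IH]; rewrite ?expr0 ?nrm1 // !exprS nrmM IH. Qed.

Lemma ReB a b : complex.Re (a - b) = complex.Re a - complex.Re b.
Proof. by case: a => ? ?; case: b. Qed.
Lemma ReD a b : complex.Re (a + b) = complex.Re a + complex.Re b.
Proof. by case: a => ? ?; case: b. Qed.
Lemma ReN a : complex.Re (- a) = - complex.Re a.
Proof. by case: a. Qed.
Lemma ReZ (t : R) a : complex.Re (t%:C * a) = t * complex.Re a.
Proof. by case: a => ? ? /=; rewrite mul0r subr0. Qed.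
Lemma conj_realC (t : R) : (t%:C)^* = t%:C.
Proof. exact: conjc_real. Qed.

Lemma conj_imag : ('i : R[i])^* = - 'i.
Proof. by apply/eqP; rewrite eq_complex /= oppr0 !eqxx. Qed.

Lemma Re_conjc a : complex.Re a^* = complex.Re a.
Proof. by case: a. Qed.

End ScalarNorm.

Section InnerProduct.
Variables (R : realType) (H : hilbertType R).
Implicit Types x y z : H.

Lemma dotDl x y z : hdot (x + y) z = hdot x z + hdot y z.
Proof. exact: linearDl. Qed.
Lemma dotDr x y z : hdot z (x + y) = hdot z x + hdot z y.
Proof. exact: linearDr. Qed.
Lemma dotNl x z : hdot (- x) z = - hdot x z.
Proof. exact: linearNl. Qed.
Lemma dotNr x z : hdot z (- x) = - hdot z x.
Proof. exact: linearNr. Qed.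
Lemma dotBl x y z : hdot (x - y) z = hdot x z - hdot y z.
Proof. by rewrite dotDl dotNl. Qed.
Lemma dotBr x y z : hdot z (x - y) = hdot z x - hdot z y.
Proof. by rewrite dotDr dotNr. Qed.
Lemma dot0l z : hdot 0 z = 0.
Proof. exact: linear0l. Qed.
Lemma dot0r z : hdot z 0 = 0.
Proof. exact: linear0r. Qed.
Lemma dotZl a x z : hdot (a *: x) z = a * hdot x z.
Proof. by rewrite linearZl_LR. Qed.
Lemma dotZr a x z : hdot z (a *: x) = a^* * hdot z x.
Proof. by rewrite linearZr_LR. Qed.
Lemma dot_suml I (r : seq I) P (F : I -> H) z :
  hdot (\sum_(i <- r | P i) F i) z = \sum_(i <- r | P i) hdot (F i) z.
Proof. exact: linear_sumlz. Qed.
Lemma dotC x y : hdot x y = (hdot y x)^*.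
Proof. by rewrite (hermC (hdot : {dot H for _})) expr0 mul1r. Qed.

Lemma dotxx x : hdot x x = (nrm x ^+ 2)%:C.
Proof. by rewrite hdot_norm nrmE rmorphXn. Qed.

(** The underlying real inner product.  By [rdot_inj] it separates vectors, so
    equalities of vectors can be tested on it as well. *)
Definition rdot x y : R := complex.Re (hdot x y).

Lemma rdotC x y : rdot x y = rdot y x.
Proof. by rewrite /rdot dotC Re_conjc. Qed.
Lemma rdotDl x y z : rdot (x + y) z = rdot x z + rdot y z.
Proof. by rewrite /rdot dotDl ReD. Qed.
Lemma rdotDr x y z : rdot z (x + y) = rdot z x + rdot z y.
Proof. by rewrite /rdot dotDr ReD. Qed.
Lemma rdotNl x z : rdot (- x) z = - rdot x z.
Proof. by rewrite /rdot dotNl ReN. Qed.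
Lemma rdotNr x z : rdot z (- x) = - rdot z x.
Proof. by rewrite /rdot dotNr ReN. Qed.
Lemma rdotZl (t : R) x z : rdot (t%:C *: x) z = t * rdot x z.
Proof. by rewrite /rdot dotZl ReZ. Qed.
Lemma rdotZr (t : R) x z : rdot z (t%:C *: x) = t * rdot z x.
Proof. by rewrite rdotC rdotZl rdotC. Qed.
Lemma rdot0r z : rdot z 0 = 0.
Proof. by rewrite /rdot dot0r. Qed.
Lemma rdot0l z : rdot 0 z = 0.
Proof. by rewrite /rdot dot0l. Qed.
Lemma rdot_suml I (s : seq I) (F : I -> H) z :
  rdot (\sum_(i <- s) F i) z = \sum_(i <- s) rdot (F i) z.
Proof.
exact: (big_morph (fun x => rdot x z) (fun x y => rdotDl x y z) (rdot0l z)).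
Qed.
Lemma rdotxx x : rdot x x = nrm x ^+ 2.
Proof. by rewrite /rdot dotxx. Qed.

Definition rdotE := (rdotDl, rdotDr, rdotNl, rdotNr, rdotZl, rdotZr).

Lemma rdot_le x y : rdot x y <= nrm x * nrm y.
Proof.
have [->|/nrm_gt0 y0] := eqVneq y 0; first by rewrite nrm0 rdot0r mulr0.
pose t := rdot x y / nrm y ^+ 2.
have := sqr_ge0 (nrm (x - t%:C *: y)).
rewrite -rdotxx !rdotE !rdotxx (rdotC y x) => h.
have e : t * nrm y ^+ 2 = rdot x y by rewrite /t divfK // gt_eqF // exprn_gt0.
rewrite e in h.
have h2 : rdot x y ^+ 2 <= (nrm x * nrm y) ^+ 2.
  rewrite exprMn {1}expr2 -{1}e mulrAC ler_wpM2r ?sqr_ge0 //; lra.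
have n0 : 0 <= nrm x * nrm y by rewrite mulr_ge0 // nrm_ge0.
case: (lerP 0 (rdot x y)) => d0; last exact: ltW (lt_le_trans d0 n0).
by move: h2; rewrite ler_sqr.
Qed.

Lemma dot_le x y : nrm (hdot x y) <= nrm x * nrm y.
Proof.
(* Multiplying x by the conjugate of c makes the product real. *)
pose c := hdot x y; have [c0|c0] := eqVneq c 0.
  by rewrite -/c c0 nrm0 mulr_ge0 // nrm_ge0.
have := rdot_le (c^* *: x) y.
rewrite /rdot dotZl -/c [c^* * c]mulrC -sqr_normc nrmE -rmorphXn /=.
by rewrite nrmZ nrm_conj expr2 -mulrA ler_pM2l // nrm_gt0.
Qed.

Lemma nrmD_sqr x y : nrm (x + y) ^+ 2 = nrm x ^+ 2 + 2 * rdot x y + nrm y ^+ 2.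
Proof. by rewrite -!rdotxx !rdotE (rdotC y x); ring. Qed.

Lemma nrmB_sqr x y : nrm (x - y) ^+ 2 = nrm x ^+ 2 - 2 * rdot x y + nrm y ^+ 2.
Proof. by rewrite nrmD_sqr rdotNr nrmN mulrN. Qed.

Lemma rdot_eq0 x : (forall y, rdot y x = 0) -> x = 0.
Proof.
by move=> /(_ x); rewrite rdotxx => /eqP; rewrite sqrf_eq0 => /eqP/nrm_eq0.
Qed.

Lemma rdot_inj x y : (forall z, rdot z x = rdot z y) -> x = y.
Proof.
move=> h; apply/eqP; rewrite -subr_eq0; apply/eqP/rdot_eq0 => z.
by rewrite !rdotE h subrr.
Qed.

Lemma Re_dot_eq (c d : R[i]) : complex.Re c = complex.Re d ->
  complex.Re ('i * c) = complex.Re ('i * d) -> c = d.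
Proof.
by case: c d => a b [a' b'] /= -> /eqP; rewrite !mul0r !mul1r !sub0r eqr_opp
  => /eqP ->.
Qed.

End InnerProduct.

Section Complete.
Variables (R : realType) (H : hilbertType R).

(** Tracking an explicit modulus b gives a limit together with the same rate
    of convergence. *)
Lemma hilbert_complete (u : nat -> H) (b : nat -> R) :
  (forall e : R, 0 < e -> exists N, forall n, (N <= n)%N -> b n < e) ->
  (forall n k, (n <= k)%N -> nrm (u n - u k) <= b n) ->
  exists l, forall n, nrm (u n - l) <= b n.
Proof.
move=> b0 hb.
have cu : cauchy (u @ \oo).
  apply/cauchy_ballP => e e0; have := e0; rewrite ltcE => /andP[_ er0].
  have [N hN] := b0 _ er0.
  pose t := [set u k | k in [set k | (N <= k)%N]]; exists (t, t).
    by split; exists N => // k /= hk; exists k.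
  move=> [_ _] /= [[k hk <-] [l hl <-]]; rewrite -ball_normE /=.
  wlog kl : k l hk hl / (k <= l)%N.
    by case: (leqP k l) => [|/ltnW] kl h; [|rewrite distrC]; exact: h.
  rewrite nrmE ltcE /= eq_sym (ger0_Im (ltW e0)) eqxx /=.
  exact: le_lt_trans (hb _ _ kl) (hN _ hk).
have /cauchy_cvg/cvg_ex[l ul] := cu.
exists l => n; apply/ler_addgt0Pr => e e0.
have eC : 0 < e%:C :> R[i] by rewrite ltcR.
have /cvgrPdist_lt/(_ _ eC) [N _ hN] := ul.
have := hN (maxn N n) (leq_maxl _ _); rewrite nrmE ltcR => h.
rewrite -[u n](subrK (u (maxn N n))) -addrA.
apply: le_trans (nrmD _ _) _; apply: lerD; first exact/hb/leq_maxr.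
by rewrite nrmC ltW.
Qed.

End Complete.

Section LinearFunctions.
Variables (K : pzRingType) (V W : lmodType K) (A : V -> W).
Hypothesis Al : linear A.

Let B : {linear V -> W} := HB.pack A (GRing.isLinear.Build _ _ _ _ _ Al).

Lemma linD x y : A (x + y) = A x + A y. Proof. exact: (linearD B). Qed.
Lemma linZ a x : A (a *: x) = a *: A x. Proof. exact: (linearZZ B). Qed.
Lemma linN x : A (- x) = - A x. Proof. exact: (linearN B). Qed.
Lemma linB x y : A (x - y) = A x - A y. Proof. exact: (linearB B). Qed.
Lemma lin0 : A 0 = 0. Proof. exact: (linear0 B). Qed.
Lemma lin_sum I (r : seq I) P (F : I -> V) :
  A (\sum_(i <- r | P i) F i) = \sum_(i <- r | P i) A (F i).
Proof. exact: (linear_sum B). Qed.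

End LinearFunctions.

Section LaxMilgram.
Variables (R : realType) (H : hilbertType R).

Lemma natSinv_lt (e : R) : 0 < e ->
  exists N, forall n, (N <= n)%N -> n.+1%:R^-1 < e.
Proof.
move=> e0; have [N _ hN] := near_infty_natSinv_lt (PosNum e0).
by exists N => n hn; exact: hN.
Qed.

(** The slope at 0 of a function of t with its minimum at 0; the witness is
    close to the minimizer -g / a, but makes sense when a = 0. *)
Lemma quadratic_ge0_slope0 (g a : R) : 0 <= a ->
  (forall t, 0 <= 2 * t * g + t ^+ 2 * a) -> g = 0.
Proof.
move=> a0 /(_ (- g / (a + 1))) h; apply/eqP; rewrite -sqrf_eq0; apply/eqP.
have a1 : 0 < a + 1 by lra.
have g2 := sqr_ge0 g.
have : 0 <= - (g ^+ 2 * (a + 2)) / (a + 1) ^+ 2.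
  by apply: le_trans h _; rewrite le_eqVlt; apply/orP; left; apply/eqP; field; lra.
rewrite pmulr_lge0 ?invr_gt0 ?exprn_gt0 // oppr_ge0 => h2.
apply/le_anti; rewrite g2 andbT; nra.
Qed.

(** The solution minimizes J x = <Q x, x> - 2 f x.  By the parallelogram
    identity and coercivity, minimizing sequences are Cauchy; the slopes of J
    at the limit vanish, which is the equation.  The case Q = 1 is the Riesz
    theorem, the case f = <., y> says that Q is onto. *)
Lemma lax_milgram (Q : H -> H) (f : H -> R) (c M N : R) : linear Q -> 0 < c ->
  (forall x y, rdot (Q x) y = rdot x (Q y)) ->
  (forall x, c * nrm x ^+ 2 <= rdot (Q x) x) ->
  (forall x, nrm (Q x) <= N * nrm x) ->
  (forall x y, f (x + y) = f x + f y) ->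
  (forall t x, f (t%:C *: x) = t * f x) ->
  (forall x, f x <= M * nrm x) ->
  exists z, forall x, f x = rdot (Q z) x.
Proof.
move=> Ql c0 Qs Qc QN fD fZ fM.
pose J x := rdot (Q x) x - 2 * f x.
have JD x y (t : R) : J (x + t%:C *: y) =
    J x + 2 * t * (rdot (Q x) y - f y) + t ^+ 2 * rdot (Q y) y.
  rewrite /J (linD Ql) (linZ Ql) fD fZ !rdotE (rdotC (Q y) x) -Qs; ring.
have Jlb x : - (M ^+ 2 / c) <= J x.
  rewrite /J; have h1 := Qc x; have h2 := fM x.
  have : 0 <= c * (nrm x - M / c) ^+ 2 by rewrite mulr_ge0 ?sqr_ge0 // ltW.
  have -> : c * (nrm x - M / c) ^+ 2 = c * nrm x ^+ 2 - 2 * (M * nrm x) + M ^+ 2 / c.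
    by field; lra.
  by lra.
pose S := [set J x | x in setT].
have Slb : has_lbound S by exists (- (M ^+ 2 / c)) => _ [x _ <-].
have S0 : S !=set0 by exists (J 0); exists 0.
have Jd x : inf S <= J x by apply: ge_inf => //; exists x.
have k0 k : 0 < k.+1%:R^-1 :> R by rewrite invr_gt0.
have /choice[u uJ] k : exists x, J x < inf S + k.+1%:R^-1.
  by have [_ [x _ <-] h] := inf_adherent (k0 k) (conj S0 Slb); exists x.
pose b k := Num.sqrt (4 / c * k.+1%:R^-1) : R.
have bP e : 0 < e -> exists N0, forall n, (N0 <= n)%N -> b n < e.
  move=> e0; have e2 : 0 < e ^+ 2 / (4 / c) by rewrite !divr_gt0 // exprn_gt0.
  have [N0 hN0] := natSinv_lt e2; exists N0 => n /hN0.
  rewrite ltr_pdivlMr ?divr_gt0 // mulrC => h.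
  by rewrite -[e]gtr0_norm // -sqrtr_sqr ltr_sqrt // exprn_gt0.
have [|l ul] := hilbert_complete bP (u := u).
  move=> n k nk; rewrite nrmC; set y := u k - u n.
  have h1 := uJ n; have h2 := uJ k; have h3 := Qc y.
  have h4 : k.+1%:R^-1 <= n.+1%:R^-1 :> R.
    by rewrite lef_pV2 ?posrE ?ltr0n // ler_nat.
  have := JD (u n) y 1; rewrite scale1r addrC subrK => h5.
  (* at the midpoint, J is at least its infimum: parallelogram identity *)
  have := Jd (u n + 2^-1%:C *: y); rewrite JD => h6.
  rewrite -(ger0_norm (nrm_ge0 _)) -sqrtr_sqr ler_sqrt; last first.
    by rewrite mulr_ge0 ?divr_ge0 // ltW.
  rewrite mulrAC ler_pdivlMr // [_ * c]mulrC; apply: le_trans h3 _.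
  move: h1 h2 h4 h6; rewrite h5; move: (n.+1%:R^-1) (k.+1%:R^-1) => p q; lra.
exists l => x; apply/eqP; rewrite -subr_eq0 -oppr_eq0 opprB; apply/eqP.
apply: (@quadratic_ge0_slope0 _ (rdot (Q x) x)) => [|t].
  by apply: le_trans (Qc x); rewrite mulr_ge0 ?sqr_ge0 // ltW.
apply/ler_addgt0Pr => e e0.
pose C := `|2 * t| * (`|N| * nrm x) + 1.
have C0 : 0 < C by rewrite ltr_wpDl // !mulr_ge0 // nrm_ge0.
have [N1 hN1] := natSinv_lt (divr_gt0 e0 (ltr0n R 2)).
have [N2 hN2] := bP (e / 2 / C) (divr_gt0 (divr_gt0 e0 (ltr0n R 2)) C0).
pose n := maxn N1 N2.
have := hN1 n (leq_maxl _ _); have := hN2 n (leq_maxr _ _).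
rewrite ltr_pdivlMr // => hb hn.
have := Jd (u n + t%:C *: x); rewrite JD => h1; have h2 := uJ n.
have h3 : `|2 * t * rdot (Q (u n - l)) x| <= C * b n.
  rewrite normrM; have : `|rdot (Q (u n - l)) x| <= `|N| * nrm x * b n.
    rewrite ler_norml lerNl -rdotNl -(linN Ql); apply/andP.
    have hh y : nrm y = nrm (u n - l) -> rdot (Q y) x <= `|N| * nrm x * b n.
      move=> hy; apply: le_trans (rdot_le _ _) _.
      rewrite mulrAC ler_wpM2r ?nrm_ge0 //; apply: le_trans (QN _) _; rewrite hy.
      apply: le_trans (ler_wpM2r (nrm_ge0 _) (ler_norm N)) _.
      by rewrite ler_wpM2l // ul.
    by rewrite !hh // nrmN.
  move=> h; apply: le_trans (ler_wpM2l (normr_ge0 _) h) _.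
  by rewrite mulrA ler_wpM2r ?sqrtr_ge0 // lerDl.
rewrite (linB Ql) rdotDl rdotNl in h3.
move: h3 hn h2; rewrite ler_norml => /andP[h3 h4]; move: (n.+1%:R^-1) => q; lra.
Qed.

End LaxMilgram.

(** * Bounded operators and adjoints *)

Section BoundedOperators.
Variable R : realType.

(** Bounded operators as bare functions, so that sums, composites and adjoints
    need no packaging. *)
Definition bounded_op (H K : hilbertType R) (A : H -> K) : Prop :=
  linear A /\ exists2 M, 0 <= M & forall x, nrm (A x) <= M * nrm x.

Definition adjoint (H K : hilbertType R) (A : H -> K) (B : K -> H) : Prop :=
  forall x y, hdot (A x) y = hdot x (B y).

Lemma boundedOp_bounded (H K : hilbertType R) (A : boundedOp H K) : bounded_op A.
Proof.
split; first exact: linearP.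
have /linear_boundedP/pinfty_ex_gt0[M M0 hM] : bounded_near A (nbhs 0).
  by apply/linear_bounded_continuous => x; exact: cts_fun.
exists (nrm M) => [|x]; first exact: nrm_ge0.
by rewrite -lecR rmorphM /= -!nrmE (gtr0_norm M0); exact: hM.
Qed.

Lemma riesz (H : hilbertType R) (f : H -> R[i]) M :
  (forall a x y, f (a *: x + y) = a * f x + f y) ->
  (forall x, nrm (f x) <= M * nrm x) -> exists z, forall x, f x = hdot x z.
Proof.
move=> fl fM.
have f0 : f 0 = 0.
  by have := fl (-1) 0 0; rewrite scaler0 addr0 mulN1r addNr.
have fZ a x : f (a *: x) = a * f x by have := fl a x 0; rewrite !addr0 f0 addr0.
have idl : linear (idfun : H -> H) by [].
have [||||||z hz] :=
  @lax_milgram _ H idfun (fun x => complex.Re (f x)) 1 M 1 idl ltr01.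
- by [].
- by move=> x; rewrite mul1r rdotxx.
- by move=> x; rewrite mul1r.
- by move=> x y; rewrite -{1}[x]scale1r fl mul1r ReD.
- by move=> t x; rewrite fZ ReZ.
- move=> x; apply: le_trans (fM x); apply: le_trans (Re_le_nrm _).
  exact: ler_norm.
exists z => x; apply: Re_dot_eq; first by rewrite hz rdotC.
by rewrite -fZ hz rdotC /rdot dotZl.
Qed.

Lemma adjoint_ex (H K : hilbertType R) (A : H -> K) :
  bounded_op A -> exists B, adjoint A B.
Proof.
move=> [Al [M M0 AM]].
have /choice[B hB] : forall y, exists z, forall x, hdot (A x) y = hdot x z.
  move=> y; apply: (@riesz H (fun x => hdot (A x) y) (M * nrm y)).
    by move=> a u v; rewrite (linD Al) (linZ Al) dotDl dotZl.
  move=> x; apply: le_trans (dot_le _ _) _.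
  by rewrite mulrAC ler_wpM2r ?nrm_ge0.
by exists B => x y; exact: hB.
Qed.

(** By the Riesz theorem, the choice in the definition of [adj] succeeds. *)
Lemma adjP (H K : hilbertType R) (A : boundedOp H K) : adjoint A (adj A).
Proof.
move=> x y; have [B AB] := adjoint_ex (boundedOp_bounded A).
rewrite /adj; case: xgetP => [z _ /(_ x)//|/(_ (B y)) h].
by exfalso; apply: h => u; exact: AB.
Qed.

Section Adjoint.
Variables (H K : hilbertType R).

Lemma adjoint_sym (A : H -> K) B : adjoint A B -> adjoint B A.
Proof. by move=> AB x y; rewrite dotC -AB -dotC. Qed.

Lemma adjoint_rdot (A : H -> K) B : adjoint A B ->
  forall x y, rdot (A x) y = rdot x (B y).
Proof. by move=> AB x y; rewrite /rdot AB. Qed.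

Lemma adjoint_uniq (A : H -> K) B B' :
  adjoint A B -> adjoint A B' -> B = B'.
Proof.
move=> AB AB'; apply/funext => y; apply: rdot_inj => z.
by rewrite -!(adjoint_rdot AB, adjoint_rdot AB').
Qed.

Lemma adjoint_linear (A : H -> K) B : adjoint A B -> linear B.
Proof.
move=> AB a x y; apply: rdot_inj => z; rewrite /rdot.
by rewrite -AB !dotDr !dotZr !AB.
Qed.

Lemma adjoint_bound (A : H -> K) B M : 0 <= M -> adjoint A B ->
  (forall x, nrm (A x) <= M * nrm x) -> forall y, nrm (B y) <= M * nrm y.
Proof.
move=> M0 AB AM y; have [->|/nrm_gt0 b0] := eqVneq (B y) 0.
  by rewrite nrm0 mulr_ge0 // nrm_ge0.
rewrite -(ler_pM2l b0) -expr2 -rdotxx -(adjoint_rdot AB).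
apply: le_trans (rdot_le _ _) _; rewrite [nrm (B y) * _]mulrC mulrAC.
by rewrite ler_wpM2r ?nrm_ge0.
Qed.

Lemma adjoint_bounded (A : H -> K) B : bounded_op A -> adjoint A B -> bounded_op B.
Proof.
move=> [_ [M M0 AM]] AB; split; first exact: adjoint_linear AB.
by exists M => //; exact: adjoint_bound AB AM.
Qed.

End Adjoint.

Lemma adj_bounded (H K : hilbertType R) (A : boundedOp H K) : bounded_op (adj A).
Proof. exact: adjoint_bounded (boundedOp_bounded A) (adjP A). Qed.

Lemma adjointZ (H K : hilbertType R) a (A : H -> K) As :
  adjoint A As -> adjoint (fun x => a *: A x) (fun x => a^* *: As x).
Proof. by move=> hA x y; rewrite dotZl dotZr hA conjCK. Qed.

Lemma bounded_op_comp (H K L : hilbertType R) (A : H -> K) (B : K -> L) :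
  bounded_op A -> bounded_op B -> bounded_op (B \o A).
Proof.
move=> [Al [M M0 AM]] [Bl [N N0 BN]]; split=> [a x y /=|].
  by rewrite (linD Al) (linZ Al) (linD Bl) (linZ Bl).
exists (N * M) => [|x /=]; first exact: mulr_ge0.
by apply: le_trans (BN _) _; rewrite -mulrA ler_wpM2l.
Qed.

Lemma bounded_opD (H K : hilbertType R) (A B : H -> K) :
  bounded_op A -> bounded_op B -> bounded_op (fun x => A x + B x).
Proof.
move=> [Al [M M0 AM]] [Bl [N N0 BN]]; split=> [a x y /=|].
  by rewrite (linD Al) (linZ Al) (linD Bl) (linZ Bl) scalerDr addrACA.
exists (M + N) => [|x /=]; first exact: addr_ge0.
by apply: le_trans (nrmD _ _) _; rewrite mulrDl lerD.
Qed.

Lemma bounded_opZ (H K : hilbertType R) a (A : H -> K) :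
  bounded_op A -> bounded_op (fun x => a *: A x).
Proof.
move=> [Al [M M0 AM]]; split=> [b x y /=|].
  by rewrite (linD Al) (linZ Al) scalerDr !scalerA mulrC.
exists (nrm a * M) => [|x /=]; first by rewrite mulr_ge0 // nrm_ge0.
by rewrite nrmZ -mulrA ler_wpM2l ?nrm_ge0.
Qed.

Lemma bounded_op_id (H : hilbertType R) : bounded_op (@id H).
Proof. by split=> //; exists 1 => // x; rewrite mul1r. Qed.

Lemma bounded_op_sum (H K : hilbertType R) I (s : seq I) (A : I -> H -> K) :
  (forall i, bounded_op (A i)) -> bounded_op (fun x => \sum_(i <- s) A i x).
Proof.
move=> Ab; elim: s => [|i s IH].
  split=> [a x y|]; first by rewrite !big_nil scaler0 addr0.
  by exists 0 => // x; rewrite big_nil nrm0 mul0r.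
suff -> : (fun x => \sum_(j <- i :: s) A j x) = fun x => A i x + \sum_(j <- s) A j x.
  exact: bounded_opD.
by apply/funext => x; rewrite big_cons.
Qed.

Lemma coercive_surj (H : hilbertType R) (Q : H -> H) c :
  bounded_op Q -> adjoint Q Q -> 0 < c ->
  (forall x, c * nrm x ^+ 2 <= rdot (Q x) x) -> forall y, exists z, Q z = y.
Proof.
move=> [Ql [N N0 QN]] Qs c0 Qc y.
have [|||z hz] := lax_milgram (f := fun x => rdot x y) (M := nrm y) Ql c0
   (adjoint_rdot Qs) Qc QN.
- by move=> u v; rewrite rdotDl.
- by move=> t u; rewrite rdotZl.
- by move=> u; rewrite mulrC rdot_le.
by exists z; apply: rdot_inj => u; rewrite hz rdotC.
Qed.

End BoundedOperators.

(** * The Fuglede theorem *)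

Section CoefficientBounds.
Variable R : realType.
Implicit Types p : {poly R[i]}.

Lemma nrm_sqrtc (v : R[i]) r : 0 <= r -> nrm v = r ^+ 2 -> nrm (sqrtc v) = r.
Proof.
move=> r0; rewrite -{1}(sqr_sqrtc v) nrm_exp => /eqP.
by rewrite eqrXn2 ?nrm_ge0 // => /eqP.
Qed.

Lemma horner_even_odd p x :
  p.[x] = (even_poly p).[x ^+ 2] + (odd_poly p).[x ^+ 2] * x.
Proof. by rewrite -{1}[p]poly_even_odd !hornerE !horner_comp !hornerE. Qed.

Lemma nrm_half_sum (a b : R[i]) M : nrm a <= M -> nrm b <= M ->
  nrm (2^-1%:C * (a + b)) <= M.
Proof.
move=> aM bM; rewrite nrmM nrm_nneg // mulrC ler_pdivrMr //.
apply: le_trans (nrmD _ _) _; lra.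
Qed.

Lemma half_double (a : R[i]) : 2^-1%:C * (a + a) = a.
Proof.
by case: a => x y; rewrite /GRing.mul /GRing.add /=; congr (_ +i* _); field.
Qed.

(** The maximum principle at the centre of a disc.  The value of the even part
    at z ^ 2 is the mean of p z and p (- z), so it obeys the same bound on a
    circle of radius r ^ 2, it has the same value at 0, and its degree is at
    most half that of p. *)
Lemma poly_bound0 p r M : 0 <= r ->
  (forall z, nrm z = r -> nrm p.[z] <= M) -> nrm p.[0] <= M.
Proof.
elim: {p}(size p) {-2}p (leqnn (size p)) r => [|n IH] p sp r r0 pM.
  move: sp; rewrite leqn0 size_poly_eq0 => /eqP p0.
  by have := pM r%:C (nrm_nneg r0); rewrite p0 !horner0.
have [p1|p1] := leqP (size p) 1.
  by have := pM r%:C (nrm_nneg r0); rewrite [p]size1_polyC // !hornerC.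
have rr z : nrm z = r ^+ 2 -> nrm (even_poly p).[z] <= M.
  move=> zr; have wr := nrm_sqrtc r0 zr; set w := sqrtc z in wr.
  have -> : (even_poly p).[z] = 2^-1%:C * (p.[w] + p.[- w]).
    rewrite (horner_even_odd p w) (horner_even_odd p (- w)) sqrrN mulrN.
    by rewrite addrACA subrr addr0 half_double sqr_sqrtc.
  by apply: nrm_half_sum; apply: pM; rewrite ?nrmN.
have := IH (even_poly p) _ (r ^+ 2) (sqr_ge0 _) rr.
rewrite !horner_coef0 coef_even_poly; apply.
apply: leq_trans (size_even_poly p) _.
by case: (size p) p1 sp => [|[|k]] // _; rewrite uphalf_half /=; lia.
Qed.

(** Cauchy's estimate for the first coefficient, which is the value at 0 of
    the odd part divided by the variable. *)
Lemma poly_bound1 p r M : 0 < r ->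
  (forall z, nrm z = r -> nrm p.[z] <= M) -> nrm p`_1 * r <= M.
Proof.
move=> r0 pM; have r0' := ltW r0.
rewrite -ler_pdivlMr // -[p`_1]/(p`_(0.*2.+1)) -coef_odd_poly -horner_coef0.
apply: (@poly_bound0 _ (r ^+ 2)) => [|z zr]; first exact: sqr_ge0.
have wr := nrm_sqrtc r0' zr; set w := sqrtc z in wr.
rewrite ler_pdivlMr // -wr -nrmM.
have -> : (odd_poly p).[z] * w = 2^-1%:C * (p.[w] + - p.[- w]).
  rewrite (horner_even_odd p w) (horner_even_odd p (- w)) sqrrN mulrN opprB.
  by rewrite addrC addrA subrK half_double sqr_sqrtc.
by apply: nrm_half_sum; rewrite ?nrmN; apply: pM; rewrite ?nrmN.
Qed.

End CoefficientBounds.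

Section Fuglede.
Variables (R : realType) (H : hilbertType R) (N Ns : H -> H).
Hypotheses (Nb : bounded_op N) (NNs : adjoint N Ns).
Hypothesis Nn : forall x, N (Ns x) = Ns (N x).

Let Nsl : linear Ns := adjoint_linear NNs.

(** The inner derivation X |-> [N^*, X]. *)
Definition ad (X : H -> H) x := Ns (X x) - X (Ns x).

Let ad_lin (X Y : H -> H) z :
  ad (fun x => X x + z *: Y x) = fun x => ad X x + z *: ad Y x.
Proof.
by apply/funext => x; rewrite /ad (linD Nsl) (linZ Nsl) scalerBr addrACA -opprD.
Qed.

(** The value at z of this polynomial is < ((1 + z ad)^k X) x, y >. *)
Fixpoint ad_poly (x y : H) k (X : H -> H) : {poly R[i]} :=
  if k is k'.+1 then ad_poly x y k' X + 'X * ad_poly x y k' (ad X)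
  else (hdot (X x) y)%:P.

Let horner_ad_poly x y k X Y z w :
  (ad_poly x y k (fun u => X u + z *: Y u)).[w] =
  (ad_poly x y k X).[w] + z * (ad_poly x y k Y).[w].
Proof.
elim: k X Y => [|k IH] X Y /=; first by rewrite !hornerC dotDl dotZl.
rewrite !hornerE ad_lin !IH; ring.
Qed.

Let ad_poly0 x y k X : (ad_poly x y k X)`_0 = hdot (X x) y.
Proof.
elim: k X => [|k IH] X /=; first by rewrite coefC.
by rewrite coefD coefXM /= addr0 IH.
Qed.

Let ad_poly1 x y k X : (ad_poly x y k X)`_1 = k%:R * hdot (ad X x) y.
Proof.
elim: k X => [|k IH] X /=; first by rewrite coefC mul0r.
by rewrite coefD coefXM /= IH ad_poly0 -natr1 mulrDl mul1r.
Qed.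

Let commutant t X := [/\ linear X, forall x, nrm (X x) <= t * nrm x &
  forall x, X (N x) = N (X x)].

(** For X commuting with N, z ad X = S X - X S with S = z N^* - z^* N, which is
    skew-adjoint.  Hence X + z ad X = (1 + S) X (1 - S) + S X S, where
    |1 + S|^2 and |1 - S|^2 are at most 1 + |S|^2: there is no term of first
    order in |z|. *)
Let step_bound : exists2 C, 0 <= C & forall t X (z : R[i]), 0 <= t -> commutant t X ->
  commutant ((1 + C * nrm z ^+ 2) * t) (fun x => X x + z *: ad X x).
Proof.
have [Nl [n n0 Nn']] := Nb.
have Nsn := adjoint_bound n0 NNs Nn'.
(* A factor 1 + |S|^2 comes from (1 + S) X (1 - S), a factor |S|^2 from S X S,
   and |S| <= 2 |z| n. *)
exists (8 * n ^+ 2) => [|t X z t0 [Xl Xt XN]]; first by rewrite mulr_ge0 ?sqr_ge0.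
pose S x := z *: Ns x - z^* *: N x.
have SD x y : S (x + y) = S x + S y.
  by rewrite /S (linD Nl) (linD Nsl) !scalerDr opprD addrACA.
have SN x : S (- x) = - S x.
  by rewrite /S (linN Nl) (linN Nsl) !scalerN opprB opprK addrC.
have Sskew x : rdot x (S x) = 0.
  rewrite /rdot dotBr !dotZr conjCK -NNs (dotC (N x)) ReB.
  have -> (c : R[i]) : z^* * c^* = (z * c)^* by rewrite rmorphM.
  by rewrite Re_conjc subrr.
have [s es] : exists s, s = 2 * nrm z * n by eexists.
have Sn x : nrm (S x) <= s * nrm x.
  apply: le_trans (nrmB _ _) _; rewrite !nrmZ nrm_conj.
  have h1 := ler_wpM2l (nrm_ge0 z) (Nn' x); have h2 := ler_wpM2l (nrm_ge0 z) (Nsn x).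
  by rewrite es; lra.
have s0 : 0 <= s by rewrite es !mulr_ge0 // nrm_ge0.
have s21 : 0 <= 1 + s ^+ 2 by rewrite addr_ge0 ?sqr_ge0.
have S2 x : nrm (S x) ^+ 2 <= s ^+ 2 * nrm x ^+ 2.
  by rewrite -exprMn lerXn2r ?nnegrE ?nrm_ge0 ?mulr_ge0 ?nrm_ge0.
have S1 x : nrm (x + S x) ^+ 2 <= (1 + s ^+ 2) * nrm x ^+ 2.
  by rewrite nrmD_sqr Sskew mulr0 addr0 mulrDl mul1r lerD2l.
have S1' x : nrm (x - S x) ^+ 2 <= (1 + s ^+ 2) * nrm x ^+ 2.
  by rewrite nrmB_sqr Sskew mulr0 subr0 mulrDl mul1r lerD2l.
split.
- move=> a x y; rewrite /ad (linD Xl) (linZ Xl) (linD Nsl) (linZ Nsl).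
  rewrite (linD Nsl) (linZ Nsl) (linD Xl) (linZ Xl) opprD addrACA -scalerBr.
  by rewrite !scalerDr !scalerA addrACA (mulrC z a).
- move=> x; have -> : X x + z *: ad X x =
     X (x - S x) + S (X (x - S x)) + S (X (S x)).
    rewrite (linB Xl) SD SN -[RHS]addrA subrK -addrA; congr (_ + _).
    rewrite /S /ad (linB Xl) !(linZ Xl) XN scalerBr opprB addrC.
    by rewrite addrA subrK.
  set y := X (x - S x).
  have h1 : nrm (y + S y) <= (1 + s ^+ 2) * (t * nrm x).
    have h0 : 0 <= (1 + s ^+ 2) * (t * nrm x) by rewrite !mulr_ge0 ?nrm_ge0.
    rewrite -ler_sqr ?nnegrE ?nrm_ge0 //; apply: le_trans (S1 _) _.
    rewrite [leRHS]exprMn [(1 + s ^+ 2) ^+ 2]expr2 -mulrA ler_wpM2l //.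
    have : nrm y ^+ 2 <= (t * nrm (x - S x)) ^+ 2.
      by rewrite lerXn2r ?nnegrE ?nrm_ge0 ?mulr_ge0 ?nrm_ge0 //; exact: Xt.
    by move=> /le_trans; apply; rewrite !exprMn mulrCA ler_wpM2l ?sqr_ge0.
  have h2 : nrm (S (X (S x))) <= s ^+ 2 * (t * nrm x).
    apply: le_trans (Sn _) _; rewrite expr2 -mulrA ler_wpM2l //.
    by apply: le_trans (Xt _) _; rewrite mulrCA ler_wpM2l.
  apply: le_trans (nrmD _ _) _; apply: le_trans (lerD h1 h2) _.
  by rewrite le_eqVlt; apply/orP; left; apply/eqP; rewrite es; ring.
- by move=> x; rewrite /ad (linD Nl) (linZ Nl) (linB Nl) XN -(Nn x) XN Nn.
Qed.

(** A discrete form of the proof by Liouville's theorem.  The first coefficient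
    of (1 + z ad)^k T is k ad T.  On the circle of radius r = 1 / j, with
    k = j ^ 2, the polynomial is bounded by (1 + C r^2)^k |T| <= e^C |T|, so
    Cauchy's estimate gives k r |ad T| = j |ad T| <= e^C |T| for all j. *)
Lemma fuglede T : bounded_op T -> (forall x, T (N x) = N (T x)) ->
  forall x, T (Ns x) = Ns (T x).
Proof.
move=> [Tl [t t0 Tt]] TN x; apply/eqP; rewrite eq_sym -subr_eq0 -/(ad T x).
apply/eqP/rdot_eq0 => y; rewrite rdotC /rdot.
suff -> : hdot (ad T x) y = 0 by [].
have [C C0 hC] := step_bound.
have bound k z : forall X t, 0 <= t -> commutant t X ->
    nrm (ad_poly x y k X).[z] <= (1 + C * nrm z ^+ 2) ^+ k * t * nrm x * nrm y.
  elim: k => [|k IH] X u u0 hX /=.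
    rewrite hornerC expr0 mul1r; apply: le_trans (dot_le _ _) _.
    by rewrite ler_wpM2r ?nrm_ge0 //; case: hX.
  rewrite hornerD hornerM hornerX -horner_ad_poly exprSr -[_ * _ * u]mulrA.
  apply: IH; last exact: hC.
  by rewrite mulr_ge0 // addr_ge0 // mulr_ge0 // sqr_ge0.
apply: nrm_eq0; apply/le_anti; rewrite nrm_ge0 andbT.
pose B := expR C * t * nrm x * nrm y.
have hB (j : nat) : j.+1%:R * nrm (hdot (ad T x) y) <= B.
  pose r : R := j.+1%:R^-1; have r0 : 0 < r by rewrite invr_gt0.
  have hz z : nrm z = r -> nrm (ad_poly x y (j.+1 ^ 2) T).[z] <= B.
    move=> zr; have hT : commutant t T by split.
    apply: le_trans (bound _ _ _ _ t0 hT) _; rewrite zr /B.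
    do 3! [rewrite ler_wpM2r ?nrm_ge0 //].
    have -> : expR C = expR ((j.+1 ^ 2)%:R * (C * r ^+ 2)).
      by congr expR; rewrite natrX /r mulrCA -exprMn mulfV // expr1n mulr1.
    by rewrite expRM_natl lerXn2r ?nnegrE ?expR_ge0 ?expR_ge1Dx // addr_ge0 //
       mulr_ge0 // sqr_ge0.
  have := poly_bound1 r0 hz; rewrite ad_poly1 nrmM.
  rewrite -[_%:R](rmorph_nat (real_complex R)) nrm_nneg // natrX /r.
  by rewrite mulrAC expr2 mulfK.
have B0 : 0 <= B by rewrite !mulr_ge0 ?expR_ge0 ?nrm_ge0.
apply/ler_addgt0Pr => e e0; rewrite add0r.
have [j hj] := natSinv_lt (divr_gt0 e0 (ltr_wpDl B0 ltr01)).
have := hj j (leqnn j); rewrite ltr_pdivlMr ?ltr_wpDl // mulrC ltr_pdivrMr // => h.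
rewrite -(ler_pM2l (ltr0Sn R j)) mulrC [leRHS]mulrC; apply: le_trans (ltW h).
by rewrite mulrC; apply: le_trans (hB j) _; rewrite lerDl.
Qed.

End Fuglede.

(** * Joint approximate eigenvectors of commuting operators *)

Section PowerMethod.
Variables (R : realType) (H : hilbertType R) (P : H -> H) (C : R).
Hypotheses (Pl : linear P) (Ps : adjoint P P).
Hypothesis P1 : forall x, nrm x ^+ 2 <= rdot (P x) x.
Hypothesis PC : forall x, nrm (P x) <= C * nrm x.

Lemma power_expanding x : nrm x <= nrm (P x).
Proof.
have [->|/nrm_gt0 x0] := eqVneq x 0; first by rewrite nrm0 nrm_ge0.
rewrite -(ler_pM2r x0) -expr2; exact: le_trans (P1 x) (rdot_le _ _).
Qed.

Lemma iter_expanding k x : nrm x <= nrm (iter k P x).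
Proof.
by elim: k => //= k IH; exact: le_trans IH (power_expanding _).
Qed.

(** The growth ratios rho_k = |P^(k+1) x| / |P^k x| lie in ]0, C], so among K of
    them there is one whose square increases by at most d = C^2 / K at the
    next step.  For y = P^k x, the square of |P^2 y - rho_k^2 y| is
    rho_k^2 (rho_(k+1)^2 - rho_k^2) |y|^2, and P + rho_k >= 1 can be cancelled
    from P^2 - rho_k^2 = (P + rho_k) (P - rho_k). *)
Lemma power_method (K : nat) (e : R) x : x != 0 -> 0 < e -> (0 < K)%N ->
  C ^+ 4 <= e ^+ 2 * K%:R ->
  exists k, exists2 rho : R, (k < K)%N /\ 0 <= rho <= C &
    nrm (P (iter k P x) - rho%:C *: iter k P x) <= e * nrm (iter k P x).
Proof.
move=> x0 e0 K0 CK.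
pose r k := nrm (iter k P x).
have r0 k : 0 < r k by apply: lt_le_trans (nrm_gt0 x0) (iter_expanding k x).
pose rho k := r k.+1 / r k.
have rhoE k : r k.+1 = rho k * r k by rewrite /rho divfK // gt_eqF.
have rho_gt0 k : 0 < rho k by rewrite divr_gt0.
have rhoC k : rho k <= C by rewrite ler_pdivrMr // PC.
have C0 : 0 < C by apply: lt_le_trans (rho_gt0 0%N) (rhoC 0%N).
have KR : 0 < K%:R :> R by rewrite ltr0n.
pose d := C ^+ 2 / K%:R.
have [e0' C0'] := (ltW e0, ltW C0).
have r0' k : 0 <= r k by rewrite ltW.
have rho0' k : 0 <= rho k by rewrite ltW.
have [k kK hk] : exists2 k, (k < K)%N & rho k.+1 ^+ 2 <= rho k ^+ 2 + d.
  apply: contrapT => hn.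
  have : forall k, (k <= K)%N -> k%:R * d < rho k ^+ 2.
    elim=> [|k IH] kK; first by rewrite mul0r exprn_gt0.
    rewrite -natr1 mulrDl mul1r; apply: (@lt_trans _ _ (rho k ^+ 2 + d)).
      by rewrite ltrD2r IH // ltnW.
    by rewrite ltNge; apply/negP => h; apply: hn; exists k.
  move=> /(_ K (leqnn K)); rewrite /d mulrC divfK ?gt_eqF // ltNge => /negP; apply.
  by rewrite lerXn2r ?nnegrE.
exists k, (rho k); first by split=> //; rewrite rho0' rhoC.
set y := iter k P x; set z := P y - _.
have yE : nrm y = r k by [].
have PyE : nrm (P y) = rho k * r k by rewrite -rhoE.
have PPyE : nrm (P (P y)) = rho k.+1 * (rho k * r k) by rewrite -rhoE -rhoE.
have zE : P z + (rho k)%:C *: z = P (P y) - (rho k ^+ 2)%:C *: y.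
  rewrite /z (linB Pl) (linZ Pl) scalerBr scalerA -rmorphM -expr2.
  by rewrite addrA subrK.
have zn : nrm (P z + (rho k)%:C *: z) <= e * r k.
  rewrite zE -ler_sqr ?nnegrE ?nrm_ge0 ?mulr_ge0 //.
  rewrite nrmB_sqr nrmZ nrm_nneg ?sqr_ge0 // rdotZr (adjoint_rdot Ps) rdotxx.
  rewrite PPyE PyE yE.
  have -> : (rho k.+1 * (rho k * r k)) ^+ 2 -
       2 * (rho k ^+ 2 * (rho k * r k) ^+ 2) + (rho k ^+ 2 * r k) ^+ 2 =
     rho k ^+ 2 * (rho k.+1 ^+ 2 - rho k ^+ 2) * r k ^+ 2 by ring.
  rewrite [leRHS]exprMn ler_wpM2r ?sqr_ge0 //.
  apply: (@le_trans _ _ (rho k ^+ 2 * d)).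
    by rewrite ler_wpM2l ?sqr_ge0 //; lra.
  apply: (@le_trans _ _ (C ^+ 2 * d)).
    by rewrite ler_wpM2r ?divr_ge0 ?sqr_ge0 ?ler0n // lerXn2r ?nnegrE.
  by rewrite /d mulrA -exprD ler_pdivrMr.
have [z0|/nrm_gt0 z0] := eqVneq z 0.
  by rewrite z0 nrm0 mulr_ge0 ?nrm_ge0.
rewrite -(ler_pM2r z0) yE; apply: (@le_trans _ _ (rdot (P z + (rho k)%:C *: z) z)).
  rewrite rdotDl rdotZl rdotxx -expr2; apply: le_trans (P1 z) _.
  by rewrite lerDl mulr_ge0 ?sqr_ge0.
by apply: le_trans (rdot_le _ _) _; rewrite ler_wpM2r ?nrm_ge0.
Qed.

End PowerMethod.

Section JointApprox.
Variables (R : realType) (H : hilbertType R).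
Implicit Types F : (H -> H) -> R[i] -> Prop.

Definition approx_eigvec F (e : R) (x : H) : Prop :=
  x != 0 /\ forall A a, F A a -> nrm (A x - a *: x) <= e * nrm x.

(** F relates operators to their prospective eigenvalues; a relation, unlike an
    indexed family, lets families with different index types be merged. *)
Definition joint_approx F : Prop :=
  forall e, 0 < e -> exists x, approx_eigvec F e x.

Definition adjoin F A a : (H -> H) -> R[i] -> Prop :=
  fun B b => F B b \/ B = A /\ b = a.

Lemma approx_eigvec_weaken F e e' x :
  e <= e' -> approx_eigvec F e x -> approx_eigvec F e' x.
Proof.
move=> ee [x0 h]; split=> // A a /h /le_trans; apply.
by rewrite ler_wpM2r ?nrm_ge0.
Qed.

(** The number a is the upper limit, as e tends to 0, of the numbers rho that
    come with an e-approximate eigenvector. *)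
Lemma joint_approx_cluster F A (C : R) :
  (forall e, 0 < e -> exists x, exists2 rho : R, 0 <= rho <= C &
     approx_eigvec (adjoin F A rho%:C) e x) ->
  exists a : R, joint_approx (adjoin F A a%:C).
Proof.
move=> h.
pose T e := [set rho | 0 <= rho <= C /\
  exists x, approx_eigvec (adjoin F A rho%:C) e x].
have T0 e : 0 < e -> T e !=set0.
  by move=> /h[x [rho rC hx]]; exists rho; split=> //; exists x.
have Tub e : has_ubound (T e) by exists C => rho [/andP[]].
have Tsub e e' : e <= e' -> T e `<=` T e'.
  move=> ee rho [rC [x hx]]; split=> //; exists x.
  exact: approx_eigvec_weaken hx.
pose S := [set sup (T e) | e in [set e | 0 < e]].
have S0 : S !=set0 by exists (sup (T 1)), 1 => //=; exact: ltr01.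
have Slb : has_lbound S.
  exists 0 => _ [e /= e0 <-]; have [rho hr] := T0 _ e0.
  by apply: le_trans (ub_le_sup (Tub e) hr); case: hr => /andP[].
exists (inf S) => e e0.
have e2 : 0 < e / 2 by rewrite divr_gt0.
have [_ [e1 /= e10 <-] he1] := inf_adherent e2 (conj S0 Slb).
pose d := Num.min e1 (e / 2).
have d0 : 0 < d by rewrite lt_min e10.
have [rho Trho hrho] := sup_adherent e2 (conj (T0 _ d0) (Tub d)).
have h1 : inf S <= sup (T d) by apply: ge_inf => //; exists d.
have h2 : rho <= sup (T e1).
  apply: ub_le_sup; first exact: Tub.
  by apply: Tsub Trho; rewrite /d ge_min lexx.
have [_ [x hx]] := Trho; exists x.
have de : d <= e / 2 by rewrite ge_min lexx orbT.
have [x0 hx'] := approx_eigvec_weaken de hx.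
split=> // B b [FB|[-> ->]].
  apply: le_trans (hx' B b (or_introl FB)) _.
  by rewrite ler_wpM2r ?nrm_ge0 //; lra.
have := hx' A rho%:C (or_intror (conj erefl erefl)) => h3.
rewrite -[A x](subrK (rho%:C *: x)) -addrA -scalerBl.
apply: le_trans (nrmD _ _) _; rewrite nrmZ -rmorphB nrm_real.
have : `|rho - inf S| <= e / 2 by rewrite ler_norml; lra.
move=> /(ler_wpM2r (nrm_ge0 x)) h4; lra.
Qed.

Lemma joint_approx_sub F F' : (forall A a, F A a -> F' A a) ->
  joint_approx F' -> joint_approx F.
Proof.
move=> FF h e e0; have [x [x0 hx]] := h e e0.
by exists x; split=> // A a /FF; exact: hx.
Qed.

(** With n a bound for |A|, the shift P = A + n + 1 satisfies P >= 1, so the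
    power method applies to it.  Its iterates commute with F and do not shrink
    vectors, so they keep an approximate eigenvector of F approximate, at the
    cost of a factor C^K that depends only on the precision required for P. *)
Lemma joint_approx_selfadjoint F A : joint_approx F -> bounded_op A -> adjoint A A ->
  (forall B b, F B b -> linear B /\ forall x, B (A x) = A (B x)) ->
  exists a : R, joint_approx (adjoin F A a%:C).
Proof.
move=> hF [Al [n n0 An]] As AF.
pose P x := A x + (n + 1)%:C *: x; pose C := 2 * n + 1.
have C1 : 1 <= C by rewrite /C; lra.
have Pl : linear P.
  move=> a x y; rewrite /P (linD Al) (linZ Al) !scalerDr !scalerA.
  by rewrite addrACA (mulrC a).
have Ps : adjoint P P.
  move=> x y; rewrite /P dotDl dotDr As dotZl dotZr.
  by rewrite conj_realC.
have P1 x : nrm x ^+ 2 <= rdot (P x) x.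
  have := rdot_le (- A x) x; rewrite nrmN rdotNl => h1.
  have h2 := ler_wpM2r (nrm_ge0 x) (An x).
  by rewrite /P rdotDl rdotZl rdotxx; lra.
have PC x : nrm (P x) <= C * nrm x.
  apply: le_trans (nrmD _ _) _; rewrite nrmZ nrm_nneg; last by lra.
  have := An x; rewrite /C; lra.
have [a ha] : exists a : R, joint_approx (adjoin F P a%:C).
  apply: (@joint_approx_cluster _ _ C) => e e0.
  pose K := (Num.truncn (C ^+ 4 / e ^+ 2)).+1.
  have hK : C ^+ 4 <= e ^+ 2 * K%:R.
    rewrite mulrC -ler_pdivrMr ?exprn_gt0 //; exact/ltW/truncnS_gt.
  have CK0 : 0 < C ^+ K by rewrite exprn_gt0 //; lra.
  have [x [x0 hx]] := hF _ (divr_gt0 e0 CK0).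
  have [k [rho [kK rhoC] hrho]] := power_method Pl Ps P1 PC x0 e0 (ltn0Sn _) hK.
  have xk := iter_expanding P1 k x.
  exists (iter k P x), rho => //; split.
    apply: contraTneq (nrm_gt0 x0) => h; rewrite -leNgt.
    by apply: le_trans xk _; rewrite h nrm0.
  move=> B b [FB|[-> ->]] //.
  have [Bl BA] := AF B b FB.
  have BP j z : B (iter j P z) = iter j P (B z).
    by elim: j => //= j IH; rewrite -IH {1}/P (linD Bl) (linZ Bl) BA.
  have iterl j : linear (iter j P).
    by elim: j => // j IH c u v /=; rewrite IH Pl.
  have iterC j z : nrm (iter j P z) <= C ^+ j * nrm z.
    elim: j => [|j IH] /=; first by rewrite expr0 mul1r.
    apply: le_trans (PC _) _; rewrite exprS -mulrA ler_wpM2l //; lra.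
  rewrite BP -(linZ (iterl k)) -(linB (iterl k)).
  apply: le_trans (iterC _ _) _; apply: le_trans (ler_wpM2l _ (hx B b FB)) _.
    by rewrite exprn_ge0 //; lra.
  rewrite mulrA; apply: (@le_trans _ _ (e * nrm x)).
    rewrite ler_wpM2r ?nrm_ge0 // mulrCA -[leRHS]mulr1 ler_wpM2l //.
      exact: ltW.
    by rewrite ler_pdivrMr // mul1r ler_weXn2l // ltnW.
  by rewrite ler_wpM2l // ltW.
exists (a - (n + 1)) => e e0; have [x [x0 hx]] := ha e e0.
exists x; split=> // B b [FB|[-> ->]]; first by apply: hx; left.
have := hx P a%:C (or_intror (conj erefl erefl)).
by rewrite /P rmorphB scalerBl opprB addrA.
Qed.

(** The selfadjoint operators N + N^* and i (N^* - N) are adjoined in turn. *)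
Lemma joint_approx_normal F N Ns : joint_approx F -> bounded_op N -> adjoint N Ns ->
  (forall x, N (Ns x) = Ns (N x)) ->
  (forall B b, F B b -> [/\ linear B, forall x, B (N x) = N (B x) &
     forall x, B (Ns x) = Ns (B x)]) ->
  exists a : R[i], joint_approx (adjoin F N a).
Proof.
move=> hF Nb NNs Nn FN; have Nsb := adjoint_bounded Nb NNs.
have [[Nl _] [Nsl _]] := (Nb, Nsb).
pose A x := N x + Ns x; pose B x := 'i *: Ns x + (- 'i) *: N x.
have Ab : bounded_op A by exact: bounded_opD.
have As : adjoint A A.
  by move=> x y; rewrite /A dotDl dotDr NNs (adjoint_sym NNs) addrC.
have Bb : bounded_op B by apply: bounded_opD; exact: bounded_opZ.
have Bs : adjoint B B.
  move=> x y; rewrite /B dotDl dotDr !dotZl !dotZr NNs (adjoint_sym NNs).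
  by rewrite rmorphN /= conj_imag opprK addrC.
have [|a ha] := joint_approx_selfadjoint hF Ab As.
  move=> T t /FN[Tl TN TNs]; split=> // x.
  by rewrite /A (linD Tl) TN TNs.
have [|b hb] := joint_approx_selfadjoint ha Bb Bs.
  move=> T t [/FN[Tl TN TNs]|[-> _]].
    by split=> // x; rewrite /B (linD Tl) !(linZ Tl) TN TNs.
  split=> [|x]; first by case: Ab.
  rewrite /A /B !(linD Nl) !(linD Nsl) !(linZ Nl) !(linZ Nsl) !scalerDr !Nn.
  by rewrite addrACA.
exists (2^-1%:C * (a%:C + 'i * b%:C)) => e e0; have [x [x0 hx]] := hb e e0.
exists x; split=> // T t [FT|[-> ->]]; first by apply: hx; left; left.
have h1 := hx A a%:C (or_introl (or_intror (conj erefl erefl))).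
have h2 := hx B b%:C (or_intror (conj erefl erefl)).
have -> : N x - 2^-1%:C * (a%:C + 'i * b%:C) *: x =
   2^-1%:C *: ((A x - a%:C *: x) + 'i *: (B x - b%:C *: x)).
  have iB : 'i *: B x = N x - Ns x.
    rewrite /B scalerDr !scalerA mulrN -expr2 sqr_i opprK scaleN1r scale1r.
    by rewrite addrC.
  rewrite scalerBr iB scalerA addrACA -opprD -scalerDl addrACA subrr addr0.
  rewrite scalerBr scalerDr -scalerDl -rmorphD scalerA; congr (_ - _).
  by rewrite (_ : 2^-1 + 2^-1 = 1 :> R) ?scale1r //; field.
rewrite nrmZ nrm_nneg // mulrC ler_pdivrMr //.
apply: le_trans (nrmD _ _) _; rewrite nrmZ nrm_i; lra.
Qed.

(** The square of the norm b of B is an approximate eigenvalue of B^* B: if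
    |B x| is close to b |x| then |B^* B x - b^2 x|^2 <= b^2 (b^2 |x|^2 - |B x|^2)
    is small. *)
Lemma joint_approx_sqnorm (B Bs : H -> H) x0 :
  bounded_op B -> adjoint B Bs -> B x0 != 0 ->
  exists2 a : R, 0 < a & joint_approx (fun A b => A = Bs \o B /\ b = a%:C).
Proof.
move=> [Bl [M M0 BM]] BBs Bx0.
pose S := [set nrm (B x) | x in [set x | nrm x <= 1]].
have S0 : S !=set0 by exists (nrm (B 0)), 0 => //=; rewrite nrm0.
have Sub : has_ubound S.
  exists M => _ [x /= x1 <-]; apply: le_trans (BM x) _.
  by rewrite -[leRHS]mulr1 ler_wpM2l.
pose b := sup S.
have unit x : x != 0 -> nrm ((nrm x)^-1%:C *: x) = 1.
  move=> x1; rewrite nrmZ nrm_nneg ?invr_ge0 ?nrm_ge0 // mulVf // gt_eqF //.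
  exact: nrm_gt0.
have bB x : nrm (B x) <= b * nrm x.
  have [->|x1] := eqVneq x 0; first by rewrite (lin0 Bl) !nrm0 mulr0.
  rewrite -ler_pdivrMr ?nrm_gt0 // mulrC.
  apply: ub_le_sup => //; exists ((nrm x)^-1%:C *: x) => /=; first by rewrite unit.
  by rewrite (linZ Bl) nrmZ nrm_nneg // invr_ge0 nrm_ge0.
have b0 : 0 < b.
  have h : 0 < nrm x0.
    by apply: nrm_gt0; apply: contraNneq Bx0 => ->; rewrite (lin0 Bl).
  by rewrite -(pmulr_lgt0 _ h); apply: lt_le_trans (nrm_gt0 Bx0) (bB _).
have bBs := adjoint_bound (ltW b0) BBs bB.
exists (b ^+ 2); first by rewrite exprn_gt0.
move=> e e0.
pose d := Num.min (b / 2) (e ^+ 2 / (2 * b ^+ 3)).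
have b3 : 0 < 2 * b ^+ 3 by rewrite mulr_gt0 // exprn_gt0.
have d0 : 0 < d by rewrite lt_min !divr_gt0 // exprn_gt0.
have d1 : d <= b / 2 by rewrite ge_min lexx.
have d2 : 2 * b ^+ 3 * d <= e ^+ 2.
  by rewrite mulrC -ler_pdivlMr // ge_min lexx orbT.
have [_ [x /= x1 <-] hx] := sup_adherent d0 (conj S0 Sub).
have xn0 : x != 0.
  by apply: contraTneq hx => ->; rewrite (lin0 Bl) nrm0 -leNgt subr_ge0 -/b; lra.
exists x; split=> // _ _ [-> ->] /=.
have Bx1 : (b - d) * nrm x <= nrm (B x).
  apply: le_trans (ltW hx); rewrite -[leRHS]mulr1 ler_wpM2l // -/b; lra.
have e0' := ltW e0; rewrite -ler_sqr ?nnegrE ?nrm_ge0 ?mulr_ge0 ?nrm_ge0 //.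
rewrite nrmB_sqr nrmZ nrm_nneg ?sqr_ge0 // rdotZr rdotC -(adjoint_rdot BBs) rdotxx.
have h1 : nrm (Bs (B x)) ^+ 2 <= b ^+ 2 * nrm (B x) ^+ 2.
  by rewrite -exprMn lerXn2r ?nnegrE ?nrm_ge0 ?mulr_ge0 ?nrm_ge0 // ltW.
have h2 : (b - d) ^+ 2 * nrm x ^+ 2 <= nrm (B x) ^+ 2.
  rewrite -exprMn lerXn2r ?nnegrE ?nrm_ge0 ?mulr_ge0 ?nrm_ge0 //; lra.
have h3 := ler_wpM2l (sqr_ge0 b) h2.
have h4 := ler_wpM2r (sqr_ge0 (nrm x)) d2.
have h5 : 0 <= b ^+ 2 * d ^+ 2 * nrm x ^+ 2 by rewrite -!exprMn sqr_ge0.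
clearbody b d; lra.
Qed.

End JointApprox.

(** * The Koszul complex and the Taylor spectrum of commuting normal operators *)

Section KoszulHomotopy.
Variables (R : realType) (H : hilbertType R) (n : nat) (T S : 'I_n -> H -> H).
Hypotheses (Tl : forall i, linear (T i)) (Sl : forall i, linear (S i)).
Hypothesis TS : forall i j x, T i (S j x) = S j (T i x).

Let below (A : {set 'I_n}) (i : 'I_n) := #|[set j in A | (j < i)%N]|.

Let belowU1 (A : {set 'I_n}) i j : j \notin A ->
  below (j |: A) i = ((j < i) + below A i)%N.
Proof.
move=> jA; rewrite /below; case: (boolP (j < i)%N) => ji.
  rewrite -[RHS]/(true + _)%N.
  have -> : [set k in j |: A | (k < i)%N] = j |: [set k in A | (k < i)%N].
    by apply/setP => k; rewrite !inE; case: eqP => // ->; rewrite ji.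
  by rewrite cardsU1 inE (negPf jA).
rewrite add0n; apply: eq_card => k; rewrite !inE.
by case: eqP => // ->; rewrite (negPf ji) !andbF.
Qed.

Definition koszul_sign A i : R[i] := (-1) ^+ below A i.

(** Contraction with the S j, the operation dual to the coboundary. *)
Definition homotopy (w : {set 'I_n} -> H) (B : {set 'I_n}) : H :=
  \sum_(j | j \notin B) koszul_sign (j |: B) j *: S j (w (j |: B)).

(** Exactly one of i < j and j < i holds, whence the sign. *)
Let sign_cross (A : {set 'I_n}) i j : i \in A -> j \notin A ->
  koszul_sign A i * koszul_sign (j |: A :\ i) j =
  - (koszul_sign (j |: A) j * koszul_sign (j |: A) i).
Proof.
move=> iA jA; have ij : i != j by apply: contraNneq jA => <-.
have jA' : j \notin A :\ i by rewrite !inE negb_and negbK jA orbT.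
rewrite /koszul_sign !belowU1 // ltnn !add0n -!exprD.
have -> : below A j = ((i < j) + below (A :\ i) j)%N.
  by rewrite -{1}(finset.setD1K iA) belowU1 // !inE eqxx.
have : (i < j)%N + (j < i)%N = 1%N :> nat.
  by case: ltngtP ij => // /val_inj ->; rewrite eqxx.
move: (below A i) (below (A :\ i) j) => a b.
case: (i < j)%N; case: (j < i)%N => //= _; rewrite !exprD ?expr1 ?expr0; ring.
Qed.

(** In both composites the diagonal terms add up to the right-hand side, those
    with i in A coming from the first and the others from the second; the
    terms that replace some i in A by some j outside A cancel by
    [sign_cross]. *)
Lemma koszul_homotopy w A :
  koszul T (homotopy w) A + homotopy (koszul T w) A = \sum_i T i (S i (w A)).
Proof.
rewrite (bigID (mem A)) /=.
have -> : koszul T (homotopy w) A = \sum_(i in A) T i (S i (w A)) +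
  \sum_(i in A) \sum_(j | j \notin A)
    (koszul_sign A i * koszul_sign (j |: A :\ i) j) *:
      T i (S j (w (j |: A :\ i))).
  rewrite /koszul -big_split /=; apply: eq_bigr => i iA.
  rewrite (lin_sum (Tl i)) (bigD1 i) ?inE ?eqxx //= finset.setD1K // scalerDr.
  congr (_ + _).
    by rewrite (linZ (Tl i)) scalerA -expr2 sqrr_sign scale1r.
  rewrite scaler_sumr; apply: eq_big => [j|j _].
    by rewrite !inE; case: eqP => [->|_]; rewrite ?iA ?andbT ?andbF.
  by rewrite (linZ (Tl i)) scalerA.
have -> : homotopy (koszul T w) A = \sum_(j | j \notin A) T j (S j (w A)) +
  \sum_(j | j \notin A) \sum_(i in A)
    (koszul_sign (j |: A) j * koszul_sign (j |: A) i) *: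
      T i (S j (w (j |: A :\ i))).
  rewrite /homotopy -big_split /=; apply: eq_bigr => j jA.
  rewrite /koszul (lin_sum (Sl j)) (bigD1 j) ?inE ?eqxx //= scalerDr.
  congr (_ + _).
    by rewrite (linZ (Sl j)) scalerA -expr2 sqrr_sign scale1r finset.setU1K // TS.
  rewrite scaler_sumr; apply: eq_big => [i|i /andP[_ ij]].
    by rewrite !inE; case: eqP => [->|_]; rewrite ?(negPf jA) ?andbT ?andbF.
  rewrite (linZ (Sl j)) scalerA TS; congr (_ *: S j (T i (w _))).
  apply/setP => k; rewrite !inE; case: eqP => // ->; case: eqP => // e.
  by rewrite e eqxx in ij.
rewrite addrACA exchange_big /= -big_split /= [X in _ + X]big1 ?addr0 // => j jA.
by rewrite -big_split /= big1 // => i iA; rewrite sign_cross // scaleNr addNr.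
Qed.

End KoszulHomotopy.

Lemma geometric_lt (R : realType) (C e : R) : 0 <= C -> 0 < e ->
  exists N, forall k, (N <= k)%N -> C * 4^-1 ^+ k < e.
Proof.
move=> C0 e0; have C1 : 0 < C + 1 by lra.
have [N hN] := natSinv_lt (divr_gt0 e0 C1); exists N => k /hN.
rewrite ltr_pdivlMr // => h; apply: le_lt_trans h.
have : 4^-1 ^+ k <= k.+1%:R^-1 :> R.
  rewrite exprVn lef_pV2 ?posrE ?exprn_gt0 ?ltr0n // -natrX ler_nat.
  exact: ltn_expl.
move=> h; apply: le_trans (ler_wpM2l C0 h) _; rewrite mulrC ler_wpM2l //.
lra.
Qed.

(** A uniform boundedness principle.  The vector w is a sum of humps t_k u_k with
    t_k = 4^-k, where u_k is skipped if the partial sum already has a large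
    product with it; then this product is at least t_k / 2 in absolute value
    after step k.  The later humps sum up to at most t_k / 3, so
    |< w, u_k >| >= t_k / 6, which is incompatible with C 16^-k = C t_k^2. *)
Lemma gliding_hump (R : realType) (H : hilbertType R) (u : nat -> H) :
  (forall k, nrm (u k) = 1) ->
  (forall w, exists C : R, forall k, nrm (hdot w (u k)) <= C * 16^-1 ^+ k) -> False.
Proof.
move=> u1 wb; have [t tE] : exists t, forall k, t k = 4^-1 ^+ k :> R by eexists.
have t0 k : 0 < t k by rewrite tE exprn_gt0 // invr_gt0.
have tS k : t k = 4 * t k.+1 by rewrite !tE exprS mulVKf.
pose hump k w := if nrm (hdot w (u k)) < t k / 2 then w + (t k)%:C *: u k else w.
pose w := fix w k := if k is k'.+1 then hump k' (w k') else 0.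
have dw k : nrm (w k - w k.+1) <= t k.
  rewrite nrmC /= /hump; case: ifP => _; last by rewrite subrr nrm0 ltW.
  by rewrite addrC addKr nrmZ u1 mulr1 nrm_nneg // ltW.
have big k : t k / 2 <= nrm (hdot (w k.+1) (u k)).
  rewrite /= /hump; case: ltP => // h.
  rewrite dotDl dotZl dotxx u1 expr1n mulr1.
  have := nrmD (hdot (w k) (u k) + (t k)%:C) (- hdot (w k) (u k)).
  rewrite addrAC subrr add0r nrmN (nrm_nneg (ltW (t0 k))) => h1.
  by move: (t k) h h1 => r h h1; lra.
pose b k := 4 / 3 * t k.
have bw n k : (n <= k)%N -> nrm (w n - w k) <= b n.
  suff h j : nrm (w n - w (n + j)%N) <= b n - b (n + j)%N.
    move=> nk; have := h (k - n)%N; rewrite subnKC //.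
    by have := t0 k; rewrite /b; lra.
  elim: j => [|j IH]; first by rewrite addn0 !subrr nrm0.
  rewrite -(subrK (w (n + j)%N) (w n)) -addrA addnS.
  apply: le_trans (nrmD _ _) _; have := dw (n + j)%N; have := tS (n + j)%N.
  by rewrite /b in IH *; lra.
have bP e : 0 < e -> exists N, forall n, (N <= n)%N -> b n < e.
  move=> e0; have [//|N hN] := @geometric_lt _ (4 / 3 : R) e _ e0.
  by exists N => n /hN; rewrite /b tE.
have [l wl] := hilbert_complete bP bw.
have [C hC] := wb l.
have C0 : 0 <= C by have := hC 0%N; rewrite expr0 mulr1; apply: le_trans (nrm_ge0 _).
have C6 : 0 <= 6 * C by lra.
have [N hN] := geometric_lt C6 (@ltr01 R).
have := hN N (leqnn N); rewrite ltNge => /negP; apply.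
have h1 := big N; have h2 := hC N; have h3 := wl N.+1.
have h4 := nrmD (hdot (w N.+1 - l) (u N)) (hdot l (u N)).
rewrite -dotDl subrK in h4.
have h5 := dot_le (w N.+1 - l) (u N); rewrite u1 mulr1 in h5.
have h6 : 16^-1 ^+ N = t N * t N :> R.
  by rewrite !tE -exprMn; congr (_ ^+ _); field.
rewrite h6 in h2; have h7 := tS N; rewrite /b in h3; rewrite -tE.
rewrite -(ler_pM2r (t0 N)); lra.
Qed.

Section CommutingNormalTuple.
Variables (R : realType) (H : hilbertType R) (n : nat) (T : 'I_n -> boundedOp H H).
Hypothesis Tcn : commuting_normal T.

(** Fuglede's theorem upgrades commutation to commutation with adjoints. *)
Lemma tuple_adj_comm i j x : T j (adj (T i) x) = adj (T i) (T j x).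
Proof.
have [Tc Tn] := Tcn.
apply: (fuglede (boundedOp_bounded (T i)) (adjP _) (Tn i) (boundedOp_bounded (T j))).
exact: Tc.
Qed.

Lemma tuple_adj_adj i j x : adj (T j) (adj (T i) x) = adj (T i) (adj (T j) x).
Proof.
apply: rdot_inj => z; rewrite -!(adjoint_rdot (adjP _)); congr rdot.
by case: Tcn => Tc _; exact: Tc.
Qed.

Lemma nrm_adj i x : nrm (adj (T i) x) = nrm (T i x).
Proof.
apply/eqP; rewrite -(eqrXn2 (n := 2)) ?nrm_ge0 // -!rdotxx; apply/eqP.
by rewrite (adjoint_rdot (adjP _)) -tuple_adj_comm rdotC (adjoint_rdot (adjP _)).
Qed.

(** Approximate eigenvectors of a normal operator are approximate eigenvectors
    of its adjoint. *)
Lemma nrm_adj_shift i a x : nrm (adj (T i) x - a^* *: x) = nrm (T i x - a *: x).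
Proof.
have e : rdot (adj (T i) x) (a^* *: x) = rdot (T i x) (a *: x).
  rewrite rdotC -(adjoint_rdot (adjP _)) /rdot (linearZ_LR (T i)) /=.
  by rewrite dotZl dotZr ?conjCK.
apply/eqP; rewrite -(eqrXn2 (n := 2)) ?nrm_ge0 //; apply/eqP.
by rewrite !nrmB_sqr nrm_adj e !nrmZ nrm_conj.
Qed.

Definition tuple_eig (lam : 'rV[R[i]]_n) : (H -> H) -> R[i] -> Prop :=
  fun B b => exists i, B = T i /\ b = lam 0 i.

(** The operators of the tuple are adjoined one after the other; each commutes
    with the adjoints of the others by [tuple_adj_comm]. *)
Lemma joint_approx_tuple F : joint_approx F ->
  (forall B b, F B b -> linear B /\ forall i x,
     B (T i x) = T i (B x) /\ B (adj (T i) x) = adj (T i) (B x)) ->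
  exists lam, joint_approx (fun B b => F B b \/ tuple_eig lam B b).
Proof.
move=> hF FT.
suff [lam h] : exists lam : 'rV_n, joint_approx (fun B b => F B b \/
    exists2 i, i \in enum 'I_n & B = T i /\ b = lam 0 i).
  exists lam; apply: joint_approx_sub h => A a [|[i hi]]; first by left.
  by right; exists i; rewrite ?mem_enum.
elim: (enum 'I_n) => [|i s [lam IH]].
  by exists 0; apply: joint_approx_sub hF => A a [//|[]].
have [[Tl _] Tn] := (boundedOp_bounded (T i), Tcn.2 i).
have [|a ha] := joint_approx_normal IH (boundedOp_bounded (T i)) (adjP (T i)) Tn.
  move=> B b [/FT[Bl BT]|[j _ [-> _]]].
    by split=> // x; case: (BT i x).
  split; [exact: linearP|exact: Tcn.1|exact: tuple_adj_comm].
exists (\row_j if j == i then a else lam 0 j).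
apply: joint_approx_sub ha => A b [FA|[j js [-> ->]]]; first by left; left.
rewrite mxE; case: eqP => [->|ji]; first by right.
by left; right; exists j => //; move: js; rewrite inE => /orP[/eqP|].
Qed.

Let shift (lam : 'rV[R[i]]_n) i x := T i x - lam 0 i *: x.
Let shift_adj (lam : 'rV[R[i]]_n) i x := adj (T i) x - (lam 0 i)^* *: x.

Let shift_bounded lam i : bounded_op (shift lam i).
Proof.
suff -> : shift lam i = fun x => T i x + (- lam 0 i) *: x.
  apply: bounded_opD; first exact: boundedOp_bounded.
  exact: bounded_opZ (@bounded_op_id _ _).
by apply/funext => x; rewrite scaleNr.
Qed.

Let shift_adjP lam i : adjoint (shift lam i) (shift_adj lam i).
Proof.
by move=> x y; rewrite dotBl dotBr dotZl dotZr conjCK adjP.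
Qed.

Let shift_comm lam i j x :
  shift lam i (shift_adj lam j x) = shift_adj lam j (shift lam i x).
Proof.
have [al _] := adj_bounded (T j).
rewrite /shift /shift_adj (linB al) (linZ al) linearB linearZ /= tuple_adj_comm.
rewrite !scalerBr !scalerA !opprB addrACA [RHS]addrACA (mulrC (lam 0 i)).
by congr (_ + _); rewrite addrC.
Qed.

(** The operator Q = \sum_i A_i^* A_i, with A_i = T_i - lam_i, is bounded below,
    hence invertible; by [koszul_homotopy], contraction with the A_i^* Q^-1 is a
    contracting homotopy of the Koszul complex. *)
Lemma not_approx_exact lam : ~ joint_approx (tuple_eig lam) ->
  koszul_exact (shift lam).
Proof.
move=> /existsNP[e /not_implyP[e0 /forallNP he]] w dw0.
pose A := shift lam; pose As := shift_adj lam.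
pose Q x := \sum_i As i (A i x).
have Al i : linear (A i) by case: (shift_bounded lam i).
have Asb i : bounded_op (As i).
  by apply: adjoint_bounded (shift_adjP lam i); exact: shift_bounded.
have Asl i : linear (As i) by case: (Asb i).
have AsP i : adjoint (As i) (A i) by apply: adjoint_sym; exact: shift_adjP.
have Qb : bounded_op Q.
  apply: bounded_op_sum => i.
  exact: bounded_op_comp (shift_bounded lam i) (Asb i).
have [Ql _] := Qb.
have Qs : adjoint Q Q.
  move=> x y; rewrite /Q dot_suml dotC dot_suml rmorph_sum; apply: eq_bigr => i _.
  by rewrite !AsP [LHS]dotC.
have Qxx x : rdot (Q x) x = \sum_i nrm (A i x) ^+ 2.
  rewrite /Q rdot_suml; apply: eq_bigr => i _.
  by rewrite (adjoint_rdot (AsP i)) rdotxx.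
have e20 : 0 < e ^+ 2 by rewrite exprn_gt0.
have Qc x : e ^+ 2 * nrm x ^+ 2 <= rdot (Q x) x.
  rewrite Qxx; have [->|x0] := eqVneq x 0.
    by rewrite nrm0 expr0n mulr0 sumr_ge0 // => i _; exact: sqr_ge0.
  have /not_andP[//|/existsNP[B /existsNP[b /not_implyP[[i [-> ->]]]]]] := he x.
  move=> /negP; rewrite -ltNge => /ltW h; rewrite (bigD1 i) //= -exprMn.
  apply: (@le_trans _ _ (nrm (A i x) ^+ 2)).
    by rewrite lerXn2r ?nnegrE ?nrm_ge0 ?mulr_ge0 ?nrm_ge0 // ltW.
  by rewrite lerDl sumr_ge0 // => k _; exact: sqr_ge0.
have /choice[V QV] := coercive_surj Qb Qs e20 Qc.
have Qinj x y : Q x = Q y -> x = y.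
  move=> h; have := Qc (x - y); rewrite (linB Ql) h subrr rdot0l => h1.
  apply/eqP; rewrite -subr_eq0; apply/eqP/nrm_eq0/eqP; rewrite -sqrf_eq0.
  by apply/eqP/le_anti; rewrite sqr_ge0 andbT -(pmulr_rle0 _ e20).
have Vl : linear V by move=> a x y; apply: Qinj; rewrite Ql !QV.
have AA i j x : A i (A j x) = A j (A i x).
  have Tl k : linear (T k) by exact: linearP.
  rewrite /A /shift (linB (Tl i)) (linB (Tl j)) (linZ (Tl i)) (linZ (Tl j)) Tcn.1.
  rewrite !scalerBr !scalerA !opprB.
  by rewrite addrACA [RHS]addrACA (mulrC (lam 0 i)); congr (_ + _); rewrite addrC.
have AAs i j x : A i (As j x) = As j (A i x) := shift_comm lam i j x.
have QA i x : Q (A i x) = A i (Q x).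
  by rewrite /Q (lin_sum (Al i)); apply: eq_bigr => j _; rewrite AAs AA.
have VA i x : V (A i x) = A i (V x) by apply: Qinj; rewrite QA !QV.
pose S i x := As i (V x).
have Sl i : linear (S i) by move=> a x y; rewrite /S Vl Asl.
have AS i j x : A i (S j x) = S j (A i x) by rewrite /S AAs VA.
exists (homotopy S w) => B.
have := koszul_homotopy Al Sl AS w B.
have -> : homotopy S (koszul A w) B = 0.
  rewrite /homotopy big1 // => j _; rewrite [koszul _ _ _]dw0 (lin0 (Sl j)).
  by rewrite scaler0.
rewrite addr0 => ->; rewrite -[RHS]QV; apply: eq_bigr => i _.
by rewrite /S AAs.
Qed.

Lemma taylor_spectrum_approx lam : taylor_spectrum T lam ->
  joint_approx (tuple_eig lam).
Proof. by move=> h; apply: contrapT => /not_approx_exact. Qed.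

(** Exactness in top degree means that each w is a sum of vectors
    (T_i - lam_i) z_i.  Then < w, u > is small for each unit vector u that the
    (T_i - lam_i)^* almost annihilate, at a rate depending on w only through a
    factor, against [gliding_hump]. *)
Lemma approx_taylor_spectrum lam : joint_approx (tuple_eig lam) ->
  taylor_spectrum T lam.
Proof.
move=> h ex; pose A := shift lam; pose As := shift_adj lam.
have e0 k : 0 < 16^-1 ^+ k :> R by rewrite exprn_gt0 // invr_gt0.
have /choice[x hx] k := h _ (e0 k).
pose u k := (nrm (x k))^-1%:C *: x k.
have x0 k : 0 < nrm (x k) by apply: nrm_gt0; case: (hx k).
have u1 k : nrm (u k) = 1.
  by rewrite nrmZ nrm_nneg ?invr_ge0 ?ltW // mulVf // gt_eqF.
have hu i k : nrm (As i (u k)) <= 16^-1 ^+ k.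
  have Asl : linear (As i) := adjoint_linear (shift_adjP lam i).
  rewrite (linZ Asl) nrmZ nrm_nneg ?invr_ge0 ?nrm_ge0 // mulrC ler_pdivrMr //.
  rewrite nrm_adj_shift; apply: (hx k).2; by exists i.
apply: (gliding_hump u1) => w.
(* w' is a top-degree form, hence closed. *)
pose w' (B : {set 'I_n}) := if B == [set: 'I_n]%SET then w else 0.
have dw B : koszul A w' B = 0.
  rewrite /koszul big1 // => i iB; rewrite /w'; case: eqP => [e|_].
    by have : i \in [set: 'I_n]%SET by []; rewrite -e !inE eqxx.
  by rewrite /A /shift linear0 !scaler0 subr0 scaler0.
have [v hv] := ex w' dw.
have := hv [set: 'I_n]%SET; rewrite /w' eqxx => <-.
pose z (i : 'I_n) :=
  (-1) ^+ #|[set j in [set: 'I_n]%SET | (j < i)%N]|%SET *: v ([set: 'I_n] :\ i)%SET.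
exists (\sum_i nrm (z i)) => k.
have -> : koszul A v [set: 'I_n]%SET = \sum_i A i (z i).
  rewrite /koszul; apply: eq_big => [i|i _]; first by rewrite inE.
  by rewrite /z /A (linZ (shift_bounded lam i).1).
rewrite dot_suml mulr_suml; apply: le_trans (nrm_sum _ _ _) _.
apply: ler_sum => i _; rewrite shift_adjP; apply: le_trans (dot_le _ _) _.
by rewrite ler_wpM2l ?nrm_ge0.
Qed.

End CommutingNormalTuple.

(** * Symmetrized points and the Gauss-Lucas theorem *)

Section Symmetrization.
Variable R : realType.
Local Notation C := R[i].

Lemma Re_div_gt0 (w z : C) : 1 < nrm w -> nrm z <= 1 -> 0 < complex.Re (w / (w - z)).
Proof.
move=> w1 z1; have wz : w - z != 0.
  by apply: contraTneq w1 => /eqP; rewrite subr_eq0 => /eqP ->; rewrite -leNgt.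
have e : w / (w - z) = (nrm (w - z) ^- 2)%:C * (w * (w - z)^*).
  rewrite [(w - z)^-1]invC_norm mulrCA nrmE -rmorphXn -rmorphV //.
  by rewrite unitfE sqrf_eq0 gt_eqF // nrm_gt0.
rewrite e ReZ pmulr_rgt0 ?invr_gt0 ?exprn_gt0 ?nrm_gt0 //.
rewrite rmorphB mulrBr ReB -normCK nrmE -rmorphXn /= subr_gt0.
apply: le_lt_trans (ler_norm _) _; apply: le_lt_trans (Re_le_nrm _) _.
rewrite nrmM nrm_conj expr2 ltr_pM2l; last by lra.
exact: le_lt_trans z1 w1.
Qed.

(** The number c is the sum of the w / (w - z) over the roots z, all of them in
    the right half-plane. *)
Lemma prod_XsubC_log_deriv (s : seq C) w : 1 < nrm w -> all (fun z => nrm z <= 1) s ->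
  let p := \prod_(z <- s) ('X - z%:P) in
  p.[w] != 0 /\ exists2 c, w * p^`().[w] = c * p.[w] &
    0 <= complex.Re c /\ (s != [::] -> 0 < complex.Re c).
Proof.
move=> w1; elim: s => [|z s IH] /=.
  rewrite big_nil hornerC oner_neq0; split=> //; exists 0 => //.
  by rewrite derivC horner0 mulr0 mul0r.
move=> /andP[z1 /IH[]]; rewrite big_cons; set q := \prod_(_ <- s) _.
move=> q0 [c hc [c0 _]].
have wz : w - z != 0.
  by apply: contraTneq w1 => /eqP; rewrite subr_eq0 => /eqP ->; rewrite -leNgt.
split; first by rewrite hornerM hornerXsubC mulf_neq0.
exists (w / (w - z) + c).
  rewrite derivM derivXsubC mul1r hornerD !hornerM hornerXsubC mulrDr.
  by rewrite mulrCA hc; field.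
have h := Re_div_gt0 w1 z1; rewrite ReD; split=> [|_]; lra.
Qed.

Lemma gauss_lucas_disc (s : seq C) w : s != [::] -> all (fun z => nrm z <= 1) s ->
  root (\prod_(z <- s) ('X - z%:P))^`() w -> nrm w <= 1.
Proof.
move=> s0 s1 /rootP hw; rewrite leNgt; apply/negP => w1.
have [p0 [c hc [_ /(_ s0) c0]]] := prod_XsubC_log_deriv w1 s1.
move: hc; rewrite hw mulr0 => /esym/eqP; rewrite mulf_eq0 (negPf p0) orbF => /eqP e.
by move: c0; rewrite e ltxx.
Qed.

Definition elem_sym n (z : 'I_n -> C) j : C :=
  \sum_(A : {set 'I_n} | #|A| == j) \prod_(k in A) z k.

Lemma coef_prod_XsubC n (z : 'I_n -> C) j : (j <= n)%N ->
  (\prod_k ('X - (z k)%:P))`_(n - j) = (-1) ^+ j * elem_sym z j.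
Proof.
move=> jn.
have -> : \prod_k ('X - (z k)%:P) =
    \sum_(A : {set 'I_n}) ((-1) ^+ #|A| * \prod_(k in A) z k)%:P * 'X^(n - #|A|).
  under eq_bigr do rewrite addrC.
  rewrite bigA_distr; apply: eq_bigr => A _.
  rewrite (bigID (mem A)) /=; congr (_ * _).
    rewrite -prodrN rmorph_prod; apply: eq_bigr => k kA.
    by rewrite kA /= rmorphN.
  rewrite (eq_bigr (fun=> 'X)) => [|k /negPf -> //].
  rewrite prodr_const; congr (_ ^+ _).
  have := cardC A; rewrite card_ord => e.
  have -> : #|(fun i => i \notin A)| = #|[predC A]| by apply: eq_card.
  by move: #|A| #|[predC A]| e => a b <-; rewrite addKn.
rewrite coef_sum /elem_sym mulr_sumr [RHS]big_mkcond /=.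
apply: eq_bigr => A _; rewrite coefCM coefXn.
have An : (#|A| <= n)%N by rewrite -[n in (_ <= n)%N]card_ord max_card.
have -> : (n - j == n - #|A|)%N = (#|A| == j) by lia.
by case: eqP => [->|_]; rewrite ?mulr1 ?mulr0.
Qed.

Lemma symmetrizationE n (z : 'rV[C]_n) i : symmetrization z 0 i = elem_sym (z 0) i.+1.
Proof. by rewrite mxE. Qed.

(** On the torus z^-1 = z^*, so that the product over the complement of A is
    the product of all coordinates times the conjugate of the product over
    A. *)
Lemma elem_sym_inversion n (z : 'I_n -> C) j : (forall k, `|z k| = 1) -> (j <= n)%N ->
  elem_sym z j = (elem_sym z (n - j)%N)^* * elem_sym z n.
Proof.
move=> z1 jn.
have zz k : (z k)^* * z k = 1 by rewrite mulrC -normCK z1 expr1n.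
have en : elem_sym z n = \prod_k z k.
  rewrite /elem_sym (big_pred1 [set: 'I_n]%SET) => [|A].
    by apply: eq_bigl => k; rewrite inE.
  have := max_card (mem A); rewrite card_ord => An.
  by rewrite /= eqEcard finset.subsetT cardsT card_ord eqn_leq An.
rewrite en rmorph_sum mulr_suml.
rewrite {1}/elem_sym (reindex_inj (@finset.setC_inj 'I_n)) /=.
apply: eq_big => [A|A _].
  by have := cardsC A; rewrite card_ord; move: #|A| #|finset.setC A| => a b; lia.
rewrite rmorph_prod [X in _ = _ * X](bigID (mem A)) /= mulrA -big_split /=.
rewrite [X in X * _]big1 => [|k _]; last exact: zz.
by rewrite mul1r; apply: eq_bigl => k; rewrite inE.
Qed.

Lemma bGamma_last m (lam : 'rV[C]_m.+1) : bGamma lam ->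
  (lam 0 ord_max)^* * lam 0 ord_max = 1.
Proof.
move=> [z /= z1 <-]; rewrite symmetrizationE.
rewrite -[RHS](_ : elem_sym (z 0) 0 = 1).
  by rewrite (elem_sym_inversion (j := 0%N) z1).
rewrite /elem_sym (big_pred1 finset.set0) ?big_set0 // => A.
by rewrite /= cards_eq0.
Qed.

Lemma bGamma_inversion m (lam : 'rV[C]_m.+1) (i : 'I_m) : bGamma lam ->
  lam 0 (below_top i) = (lam 0 (below_top (rev_ord i)))^* * lam 0 ord_max.
Proof.
move=> [z /= z1 <-]; rewrite !symmetrizationE /=.
rewrite (elem_sym_inversion z1); last exact: leqW (ltn_ord i).
by congr ((elem_sym _ _)^* * _); have := ltn_ord i; lia.
Qed.

(** The point is the symmetrization of the roots of the derivative of the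
    polynomial whose roots are the z k. *)
Lemma bGamma_derivative m (lam : 'rV[C]_m.+1) : bGamma lam ->
  Gamma (\row_i (gamma R m.+1 i.+1 * lam 0 (below_top i)) : 'rV_m).
Proof.
move=> [z /= z1 <-].
pose p := \prod_k ('X - (z 0 k)%:P).
pose q := (m.+1%:R^-1 : C) *: p^`().
have m0 : m.+1%:R != 0 :> C by rewrite pnatr_eq0.
have qE k : q`_k = m.+1%:R^-1 * k.+1%:R * p`_k.+1.
  by rewrite coefZ coef_deriv -[X in _ * X]mulr_natl mulrA.
have p_lead : p`_m.+1 = 1.
  have := @coef_prod_XsubC m.+1 (z 0) 0 (leq0n _); rewrite subn0 => ->.
  rewrite expr0 mul1r /elem_sym (big_pred1 finset.set0) ?big_set0 // => A.
  by rewrite /= cards_eq0.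
have sp : size p = m.+2.
  by rewrite size_prod_XsubC [index_enum _]unlock -enumT size_enum_ord.
have sq : size q = m.+1.
  apply/eqP; rewrite eqn_leq; apply/andP; split.
    rewrite /q size_scale ?invr_eq0 // -ltnS -sp; apply: lt_size_deriv.
    by rewrite -size_poly_eq0 sp.
  rewrite ltnNge; apply/negP => /leq_sizeP/(_ m (leqnn m)).
  by rewrite qE p_lead mulr1 mulVf // => /eqP; rewrite oner_eq0.
have lq : lead_coef q = 1 by rewrite lead_coefE sq /= qE p_lead mulr1 mulVf.
have [r hr] := closed_field_poly_normal q; rewrite lq scale1r in hr.
have sr : size r = m by have := sq; rewrite hr size_prod_XsubC => -[].
have rE : q = \prod_(k < m) ('X - ((\row_k r`_k : 'rV_m) 0 k)%:P).
  by rewrite hr (big_nth 0) sr big_mkord; apply: eq_bigr => k _; rewrite mxE.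
exists (\row_k r`_k) => /= [k|].
  rewrite mxE nrmE -[leRHS]/(1%:C) lecR.
  apply: (@gauss_lucas_disc (codom (z 0))).
  - by rewrite -size_eq0 size_codom card_ord.
  - by apply/allP => _ /codomP[j ->]; rewrite -lecR -nrmE z1.
  have : root q r`_k by rewrite hr root_prod_XsubC mem_nth // sr.
  by rewrite rootZ ?invr_eq0 // big_image_cond /=.
apply/rowP => i; rewrite symmetrizationE [RHS]mxE symmetrizationE /=.
have hi : (i.+1 <= m)%N := ltn_ord i.
apply: (@mulfI _ ((-1) ^+ i.+1)); first by rewrite signr_eq0.
transitivity (q`_(m - i.+1)).
  by rewrite rE coef_prod_XsubC.
have hp := @coef_prod_XsubC m.+1 (z 0) i.+1 (leqW hi).
have -> : q`_(m - i.+1) = gamma R m.+1 i.+1 * p`_(m.+1 - i.+1).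
  by rewrite qE -subSn // mulrC [m.+1%:R^-1 * _]mulrC mulrC.
by rewrite hp mulrCA.
Qed.

End Symmetrization.

(** * Unitary tuples over the distinguished boundary *)

Section SpectralVanishing.
Variables (R : realType) (H : hilbertType R) (n : nat) (T : 'I_n -> boundedOp H H).
Hypothesis Tcn : commuting_normal T.

(** If B is nonzero then |B|^2 > 0 is an approximate eigenvalue of B^* B; it
    extends to a joint approximate eigenvalue of B^* B and of the tuple, whose
    last part lies in the spectrum, where B is small. *)
Lemma vanish_on_spectrum (B : H -> H) : bounded_op B ->
  (forall i x, B (T i x) = T i (B x)) ->
  (forall i x, B (adj (T i) x) = adj (T i) (B x)) ->
  (forall lam, taylor_spectrum T lam -> exists C : R, forall e x,
     0 <= e -> approx_eigvec (tuple_eig T lam) e x -> nrm (B x) <= C * (e * nrm x)) ->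
  forall x, B x = 0.
Proof.
move=> Bb BT BTs hB x0; apply/eqP/negPn/negP => Bx0.
have [Bs BBs] := adjoint_ex Bb; have Bsb := adjoint_bounded Bb BBs.
have BsT i x : Bs (T i x) = T i (Bs x).
  apply: rdot_inj => y; rewrite -(adjoint_rdot BBs).
  by rewrite -!(adjoint_rdot (adjoint_sym (adjP (T i)))) -(adjoint_rdot BBs) BTs.
have BsTs i x : Bs (adj (T i) x) = adj (T i) (Bs x).
  apply: rdot_inj => y; rewrite -(adjoint_rdot BBs).
  by rewrite -!(adjoint_rdot (adjP (T i))) -(adjoint_rdot BBs) BT.
have [a a0 ha] := joint_approx_sqnorm Bb BBs Bx0.
have [|lam hlam] := joint_approx_tuple Tcn ha.
  move=> _ _ [-> _]; split; first by case: (bounded_op_comp Bb Bsb).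
  by move=> i x /=; rewrite BT BsT BTs BsTs.
have hT : taylor_spectrum T lam.
  apply: (approx_taylor_spectrum Tcn); apply: joint_approx_sub hlam => A b h.
  by right.
have [C hC] := hB _ hT; have [_ [M M0 BsM]] := Bsb.
pose D := 1 + M * `|C|; have D0 : 0 < D by rewrite ltr_pwDl // mulr_ge0.
have e0 : 0 < a / (2 * D) by rewrite divr_gt0 // mulr_gt0.
have [x [xn0 hx]] := hlam _ e0; have x1 := nrm_gt0 xn0.
move: e0 hx; set e := a / _ => e0 hx.
have h1 : nrm (B x) <= `|C| * (e * nrm x).
  apply: le_trans (hC _ _ (ltW e0) _) _; last first.
    by rewrite ler_wpM2r ?ler_norm // mulr_ge0 // ltW.
  by split=> // A b h; apply: hx; right.
have h2 := hx _ _ (or_introl (conj erefl erefl)); rewrite /= in h2.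
have h3 := nrmD (a%:C *: x - Bs (B x)) (Bs (B x)).
rewrite subrK [nrm (_ - _)]nrmC nrmZ (nrm_nneg (ltW a0)) in h3.
have h4 := le_trans (BsM (B x)) (ler_wpM2l M0 h1).
have h5 : a * nrm x <= D * e * nrm x by rewrite /D; clearbody e; lra.
rewrite ler_pM2r // /e in h5.
have h6 : D * (a / (2 * D)) = a / 2 by field; lra.
by rewrite h6 in h5; lra.
Qed.

(** The form of [vanish_on_spectrum] for the relation conj(z_i) z_j = nu(z),
    where nu(z) is the value at z of the symbol of W. *)
Lemma relation_on_spectrum i j (W : H -> H) (nu : 'rV[R[i]]_n -> R[i]) : bounded_op W ->
  (forall k x, W (T k x) = T k (W x)) ->
  (forall k x, W (adj (T k) x) = adj (T k) (W x)) ->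
  (forall lam e x, 0 <= e -> approx_eigvec (tuple_eig T lam) e x ->
     nrm (W x - nu lam *: x) <= e * nrm x) ->
  (forall lam, taylor_spectrum T lam -> nu lam = (lam 0 i)^* * lam 0 j) ->
  forall x, adj (T i) (T j x) = W x.
Proof.
move=> Wb WT WTs hW hnu x; apply/eqP; rewrite -subr_eq0; apply/eqP.
have Tb k := boundedOp_bounded (T k).
have [Wl _] := Wb; have Tl k : linear (T k) by case: (Tb k).
have Tsl k : linear (adj (T k)) by case: (adj_bounded (T k)).
pose B x := adj (T i) (T j x) - W x.
apply: (@vanish_on_spectrum B).
- suff -> : B = fun x => adj (T i) (T j x) + (-1) *: W x.
    apply: bounded_opD; last exact: bounded_opZ.
    exact: bounded_op_comp (Tb j) (adj_bounded (T i)).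
  by apply/funext => y; rewrite scaleN1r.
- move=> k y; rewrite /B WT (linB (Tl k)) (tuple_adj_comm Tcn); congr (adj (T i) _ - _).
  exact: Tcn.1.
- move=> k y; rewrite /B WTs (linB (Tsl k)) (tuple_adj_comm Tcn); congr (_ - _).
  exact: tuple_adj_adj.
move=> lam hlam; have [_ [M M0 hM]] := adj_bounded (T i).
exists (M + nrm (lam 0 j) + 1) => e y e0 hy.
have hi := hy.2 _ _ (ex_intro _ i (conj erefl erefl)).
have hj := hy.2 _ _ (ex_intro _ j (conj erefl erefl)).
rewrite -(nrm_adj_shift Tcn) in hi; have hw := hW _ _ _ e0 hy.
have -> : B y = adj (T i) (T j y - lam 0 j *: y) +
   lam 0 j *: (adj (T i) y - (lam 0 i)^* *: y) - (W y - nu lam *: y).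
  rewrite (linB (Tsl i)) (linZ (Tsl i)) scalerBr addrA subrK scalerA.
  by rewrite (mulrC (lam 0 j)) -hnu // opprB addrA subrK.
apply: le_trans (nrmB _ _) _; apply: le_trans (lerD (nrmD _ _) (lexx _)) _.
rewrite nrmZ; have h1 := le_trans (hM _) (ler_wpM2l M0 hj).
have h2 := ler_wpM2l (nrm_ge0 (lam 0 j)) hi; lra.
Qed.

End SpectralVanishing.

Section GammaUnitary.
Variables (R : realType) (m : nat) (L : hilbertType R) (U : 'I_m.+1 -> boundedOp L L).
Hypothesis UG : Gamma_unitary U.

Lemma Gamma_unitary_top x : adj (U ord_max) (U ord_max x) = x.
Proof.
have [Ucn Usp] := UG.
apply: (relation_on_spectrum Ucn (W := id) (nu := fun=> 1)) => //.
- exact: bounded_op_id.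
- by move=> lam e y e0 _; rewrite scale1r subrr nrm0 mulr_ge0 ?nrm_ge0.
- by move=> lam /Usp /bGamma_last ->.
Qed.

Lemma Gamma_unitary_below i x :
  adj (U (below_top (rev_ord i))) (U ord_max x) = U (below_top i) x.
Proof.
have [Ucn Usp] := UG.
apply: (relation_on_spectrum Ucn (W := U (below_top i))
  (nu := fun lam => lam 0 (below_top i))) => //.
- exact: boundedOp_bounded.
- move=> k y; exact: Ucn.1.
- move=> k y; exact: tuple_adj_comm.
- by move=> lam e y _ [_ hy]; apply: hy; exists (below_top i).
- by move=> lam /Usp /bGamma_inversion <-.
Qed.

(** A joint approximate eigenvalue mu of the gamma_i U_i extends to one, lam,
    of U; approximate eigenvalues being determined by their approximate
    eigenvectors, mu_i = gamma_i lam_i. *)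
Lemma Gamma_unitary_scaled_spectrum :
  let gU := fun i : 'I_m => scale_op (gamma R m.+1 i.+1) (U (below_top i)) in
  commuting_normal gU /\ taylor_spectrum gU `<=` @Gamma R m.
Proof.
move=> gU; have [Ucn Usp] := UG.
have gE i x : adj (gU i) x = (gamma R m.+1 i.+1)^* *: adj (U (below_top i)) x.
  rewrite (adjoint_uniq (adjP (gU i)) (adjointZ _ (adjP (U (below_top i))))).
  by [].
have Ul k : linear (U k) by case: (boundedOp_bounded (U k)).
have Usl k : linear (adj (U k)) by case: (adj_bounded (U k)).
have gcn : commuting_normal gU.
  split=> [i j x|i x].
    by rewrite /= !(linZ (Ul _)) !scalerA mulrC Ucn.1.
  rewrite !gE /= (linZ (Usl _)) (linZ (Ul _)) !scalerA mulrC.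
  by rewrite (tuple_adj_comm Ucn).
split=> // mu hmu.
have hF := taylor_spectrum_approx gcn hmu.
have [|lam hlam] := joint_approx_tuple Ucn hF.
  move=> _ _ [i [-> _]]; split; first by case: (boundedOp_bounded (gU i)).
  move=> j x /=; rewrite (linZ (Ul _)) (linZ (Usl _)) Ucn.1.
  by rewrite (tuple_adj_comm Ucn).
have lamS : bGamma lam.
  by apply/Usp/(approx_taylor_spectrum Ucn)/(joint_approx_sub _ hlam) => A b; right.
suff -> : mu = \row_i (gamma R m.+1 i.+1 * lam 0 (below_top i)).
  exact: bGamma_derivative.
apply/rowP => i; rewrite mxE; set g := gamma R m.+1 i.+1.
apply/eqP; rewrite -subr_eq0; apply/eqP/nrm_eq0/le_anti; rewrite nrm_ge0 andbT.
have c0 : 0 < 1 + nrm g by rewrite ltr_pwDl // nrm_ge0.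
apply/ler_addgt0Pr => e e0; rewrite add0r.
have [x [/nrm_gt0 x0 hx]] := hlam _ (divr_gt0 e0 c0).
have h1 := hx _ _ (or_introl (ex_intro _ i (conj erefl erefl))).
have h2 := hx _ _ (or_intror (ex_intro _ (below_top i) (conj erefl erefl))).
rewrite -(ler_pM2r x0) -nrmZ.
have -> : (mu 0 i - g * lam 0 (below_top i)) *: x =
   g *: (U (below_top i) x - lam 0 (below_top i) *: x) - (gU i x - mu 0 i *: x).
  by rewrite /gU /= -/g scalerBl scalerBr scalerA opprB [RHS]addrC addrA subrK.
apply: le_trans (nrmB _ _) _; rewrite nrmZ.
have h3 := ler_wpM2l (nrm_ge0 g) h2.
apply: le_trans (lerD h3 h1) _.
have eE : (1 + nrm g) * (e / (1 + nrm g)) = e by rewrite mulrC divfK // gt_eqF.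
rewrite -[X in _ <= X * _]eE.
by move: (e / _) => d; lra.
Qed.

End GammaUnitary.

(** * The defect space *)

Section Polarization.
Variables (R : realType).

Lemma positive_selfadjoint (H : hilbertType R) (D : H -> H) : linear D ->
  (forall x, 0 <= hdot (D x) x) -> adjoint D D.
Proof.
move=> Dl D0 x y; rewrite [RHS]dotC.
have hr z : complex.Im (hdot (D z) z) = 0 by exact: ger0_Im.
have := hr (x + y); have := hr (x + 'i *: y).
rewrite !(linD Dl) (linZ Dl) !dotDl !dotDr !dotZl !dotZr conj_imag.
move: (hr x) (hr y).
move: (hdot (D x) x) (hdot (D y) y) (hdot (D x) y) (hdot (D y) x).
move=> [a a'] [b b'] [c c'] [d d'] /= -> -> h1 h2.
by apply/eqP; rewrite eq_complex /=; apply/andP; split; apply/eqP; lra.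
Qed.

Lemma isometric_dot (H K : hilbertType R) (J : H -> K) : linear J ->
  (forall x, nrm (J x) = nrm x) -> forall x y, hdot (J x) (J y) = hdot x y.
Proof.
move=> Jl Jn.
have hr x y : rdot (J x) (J y) = rdot x y.
  have := nrmD_sqr (J x) (J y); rewrite -(linD Jl) !Jn nrmD_sqr; lra.
move=> x y; apply: Re_dot_eq; first exact: hr.
by rewrite -!dotZl -(linZ Jl); exact: hr.
Qed.

End Polarization.

Section DefectSpace.
Variables (R : realType) (H K : hilbertType R) (D : boundedOp H K).
Local Notation M := (csub (range_closure D)).

Lemma corange_dense (u : M) (e : R) : 0 < e -> exists x, nrm (u - corange D x) < e.
Proof.
move=> e0; have := csub_valP u; rewrite inE => cu.
have eC : 0 < e%:C :> R[i] by rewrite ltcR.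
have [_ [[x _ <-] hx]] := cu _ (nbhsx_ballx (csub_val u) _ eC).
exists x; move: hx; rewrite -ball_normE /= nrmE ltcR.
by [].
Qed.

Lemma corange_ext (L : hilbertType R) (A B : M -> L) : bounded_op A -> bounded_op B ->
  (forall x, A (corange D x) = B (corange D x)) -> forall u, A u = B u.
Proof.
move=> [Al [a a0 hA]] [Bl [b b0 hB]] AB u.
apply/eqP; rewrite -subr_eq0; apply/eqP/nrm_eq0/le_anti; rewrite nrm_ge0 andbT.
have c0 : 0 < a + b + 1 by lra.
apply/ler_addgt0Pr => e e0; rewrite add0r.
have [x /ltW hx] := corange_dense u (divr_gt0 e0 c0).
have -> : A u - B u = A (u - corange D x) - B (u - corange D x).
  by rewrite (linB Al) (linB Bl) AB opprB addrA subrK.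
apply: le_trans (nrmB _ _) _; apply: le_trans (lerD (hA _) (hB _)) _.
rewrite -mulrDl; have h : 0 <= a + b by lra.
apply: le_trans (ler_wpM2l h hx) _.
by rewrite mulrCA -[leRHS]mulr1 ler_wpM2l ?(ltW e0) // ler_pdivrMr // mul1r; lra.
Qed.

Lemma corange_linear : linear (corange D).
Proof. by move=> a x y; apply: val_inj; rewrite /= linearP. Qed.

(** The value at u is the limit of the W (g k) for a sequence D (g k) tending
    to u; it is within |u - D x| of each W x, which determines it and gives its
    properties. *)
Lemma isometry_extension (L : hilbertType R) (W : H -> L) : linear W ->
  (forall x, nrm (W x) = nrm (D x)) ->
  exists2 Theta : boundedOp M L, isometric Theta &
    forall x, Theta (corange D x) = W x.
Proof.
move=> Wl WD.
have k0 k : 0 < k.+1%:R^-1 :> R by rewrite invr_gt0.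
have /choice[g hg] (p : M * nat) := corange_dense p.1 (k0 p.2).
have WB x y : nrm (W x - W y) = nrm (corange D x - corange D y).
  by rewrite -(linB Wl) WD -(linB corange_linear).
have Wg u n x : nrm (W (g (u, n)) - W x) <= n.+1%:R^-1 + nrm (u - corange D x).
  rewrite WB -(subrK u (corange D (g (u, n)))) -addrA.
  apply: le_trans (nrmD _ _) _; rewrite lerD2r nrmC; exact/ltW/(hg (u, n)).
have /choice[th hth] u : exists l, forall n, nrm (W (g (u, n)) - l) <= 2 * n.+1%:R^-1.
  apply: hilbert_complete => [e e0|n k nk].
    have [N hN] := natSinv_lt (divr_gt0 e0 (ltr0n R 2)).
    by exists N => n /hN; rewrite ltr_pdivlMr // mulrC.
  apply: le_trans (Wg _ _ _) _; have := hg (u, k); rewrite /=.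
  have : k.+1%:R^-1 <= n.+1%:R^-1 :> R by rewrite lef_pV2 ?posrE ?ltr0n // ler_nat.
  move: (n.+1%:R^-1) (k.+1%:R^-1) => p q; lra.
have thW u x : nrm (th u - W x) <= nrm (u - corange D x).
  apply/ler_addgt0Pr => e e0.
  have [N hN] := natSinv_lt (divr_gt0 e0 (ltr0n R 3)); have := hN N (leqnn N).
  have := hth u N; have := Wg u N x; rewrite [nrm (_ - th u)]nrmC.
  have := nrmD (th u - W (g (u, N))) (W (g (u, N)) - W x); rewrite addrA subrK.
  move: (N.+1%:R^-1) => p; lra.
have thl : linear th.
  move=> a u v; apply/eqP; rewrite -subr_eq0.
  apply/eqP/nrm_eq0/le_anti; rewrite nrm_ge0 andbT.
  have c0 : 0 < 2 * (nrm a + 1) by have := nrm_ge0 a; lra.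
  apply/ler_addgt0Pr => e e0; rewrite add0r.
  have [x hx] := corange_dense u (divr_gt0 e0 c0).
  have [y hy] := corange_dense v (divr_gt0 e0 c0).
  have h1 := thW (a *: u + v) (a *: x + y); have h2 := thW u x; have h3 := thW v y.
  have h4 : nrm (a *: u + v - corange D (a *: x + y)) <=
      nrm a * nrm (u - corange D x) + nrm (v - corange D y).
    by rewrite corange_linear opprD addrACA -scalerBr -nrmZ nrmD.
  have -> : th (a *: u + v) - (a *: th u + th v) =
    (th (a *: u + v) - W (a *: x + y)) - (a *: (th u - W x) + (th v - W y)).
    by rewrite Wl scalerBr addrACA -opprD opprB addrA subrK.
  apply: le_trans (nrmB _ _) _; apply: le_trans (lerD (lexx _) (nrmD _ _)) _.
  rewrite nrmZ; have a0 := nrm_ge0 a.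
  have h5 := ler_wpM2l a0 h2; have h6 := ler_wpM2l a0 (ltW hx).
  have -> : e = 2 * (nrm a + 1) * (e / (2 * (nrm a + 1))).
    by rewrite mulrC divfK // gt_eqF.
  move: (e / _) hx hy h6 => d hx hy h6; lra.
have thn u : nrm (th u) = nrm u.
  apply/eqP; rewrite eq_le; apply/andP; split; apply/ler_addgt0Pr => e e0;
  have [x hx] := corange_dense u (divr_gt0 e0 (ltr0n R 2));
  have h := thW u x; have hW : nrm (W x) = nrm (corange D x) by rewrite WD.
    have := nrmD (th u - W x) (W x); have := nrmD (corange D x - u) u.
    by rewrite !subrK [nrm (_ - u)]nrmC; lra.
  have := nrmD (u - corange D x) (corange D x); have := nrmD (W x - th u) (th u).
  by rewrite !subrK [nrm (_ - th u)]nrmC; lra.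
have thc : continuous th.
  pose th0 : {linear M -> L} := HB.pack th (GRing.isLinear.Build _ _ _ _ _ thl).
  apply: (@bounded_linear_continuous _ _ _ th0); apply/linear_boundedP.
  exists 1; split=> [|r r1 u]; first exact: real1.
  by rewrite /= !nrmE thn -nrmE ler_peMl // ltW.
pose Theta : boundedOp M L := HB.pack th (GRing.isLinear.Build _ _ _ _ _ thl)
  (isContinuous.Build _ _ th thc).
exists Theta => [u|x]; first by rewrite /= !nrmE thn.
apply/eqP; rewrite -subr_eq0; apply/eqP/nrm_eq0/le_anti; rewrite nrm_ge0 andbT.
by apply: le_trans (thW _ _) _; rewrite subrr nrm0.
Qed.

End DefectSpace.

Section DefectOperator.
Variables (R : realType) (H : hilbertType R) (S D : boundedOp H H).
Hypothesis hD : is_defect S D.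

Lemma defect_selfadjoint : adjoint D D.
Proof.
by apply: positive_selfadjoint; [case: (boundedOp_bounded D)|case: hD].
Qed.

(** D is selfadjoint, so its kernel is orthogonal to its range. *)
Lemma defect_inj (u v : defect_space D) : D (csub_val u) = D (csub_val v) -> u = v.
Proof.
move=> h; apply/eqP; rewrite -subr_eq0; apply/eqP/nrm_eq0.
have h0 : D (csub_val (u - v)) = 0 by rewrite /= linearB /= h subrr.
move: (u - v) h0 => w h0; apply/le_anti; rewrite nrm_ge0 andbT.
apply/ler_addgt0Pr => e e0; rewrite add0r.
have [x /ltW hx] := corange_dense w e0.
have [->|/nrm_gt0 w0] := eqVneq w 0; first by rewrite nrm0 ltW.
rewrite -(ler_pM2l w0) -expr2 -rdotxx.
have -> : rdot w w = rdot w (w - corange D x).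
  rewrite rdotDr rdotNr; have -> : rdot w (corange D x) = 0; last by rewrite subr0.
  by rewrite /rdot -[hdot w _]/(hdot (csub_val w) (D x)) -defect_selfadjoint h0 dot0l.
by apply: le_trans (rdot_le _ _) _; rewrite ler_wpM2l ?nrm_ge0.
Qed.

Lemma nrm_defect x : nrm (D x) ^+ 2 = nrm x ^+ 2 - nrm (S x) ^+ 2.
Proof.
rewrite -rdotxx -(adjoint_rdot defect_selfadjoint) hD.2 rdotDl rdotNl !rdotxx.
by rewrite rdotC -(adjoint_rdot (adjP S)) rdotxx.
Qed.

End DefectOperator.

(** * Fundamental operators *)

Section FundamentalOperators.
Variables (R : realType) (m : nat) (H : hilbertType R) (S : 'I_m.+1 -> boundedOp H H).
Hypothesis Sc : commuting S.
Variable D : boundedOp H H.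
Hypothesis hD : is_defect (S ord_max) D.
Variable E : 'I_m -> boundedOp (defect_space D) (defect_space D).
Hypothesis hE : fundamental_operators S E.
Local Notation s i := (S (below_top i)).
Local Notation s' i := (S (below_top (rev_ord i))).
Local Notation p := (S ord_max).

(** The adjoint of the fundamental equation. *)
Lemma defect_adj_fundamental i x : D (csub_val (adj (E i) (corange D x))) =
  adj (s i) x - adj p (s' i x).
Proof.
apply: rdot_inj => y; rewrite -(adjoint_rdot (defect_selfadjoint hD)).
rewrite -[LHS]/(rdot (corange D y) (adj (E i) (corange D x))).
rewrite -(adjoint_rdot (adjP _)).
rewrite -[LHS]/(rdot (csub_val (E i (corange D y))) (D x)).
rewrite -(adjoint_rdot (defect_selfadjoint hD)) -hE.
rewrite rdotDl rdotNl rdotDr rdotNr -!(adjoint_rdot (adjP _)).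
by rewrite (adjoint_rdot (adjoint_sym (adjP _))).
Qed.

Lemma fundamental_kernel i x : D x = 0 -> s i x = adj (s' i) (p x).
Proof.
move=> Dx; apply/eqP; rewrite -subr_eq0 hE.
have -> : corange D x = 0 by apply: val_inj; rewrite /= Dx.
by rewrite !linear0.
Qed.

Lemma adj_comm i j x : adj (S i) (adj (S j) x) = adj (S j) (adj (S i) x).
Proof.
apply: rdot_inj => y; rewrite -!(adjoint_rdot (adjP _)); congr (rdot _ x).
exact: Sc.
Qed.

(** After applying D, this is S_i^* S_i x = S_(n-i)^* S_(n-i) x; both are equal
    to S_i^* S_(n-i)^* S_n x by [fundamental_kernel]. *)
Lemma adj_fundamental_kernel i x : D x = 0 ->
  adj (E i) (corange D (s i x)) = adj (E (rev_ord i)) (corange D (s' i x)).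
Proof.
move=> Dx; apply: (defect_inj hD); rewrite !defect_adj_fundamental rev_ordK.
have h1 := fundamental_kernel i Dx; have := fundamental_kernel (rev_ord i) Dx.
rewrite rev_ordK => h2; rewrite (Sc (below_top i)); congr (_ - _).
by rewrite {1}h1 adj_comm -h2.
Qed.

Lemma defect_comp i x : corange D (s i x) =
  E i (corange D x) + adj (E (rev_ord i)) (corange D (p x)).
Proof.
apply: (defect_inj hD); rewrite /= linearD /= -hE defect_adj_fundamental rev_ordK.
by rewrite hD.2 addrA subrK -(Sc (below_top i)).
Qed.

Lemma adj_fundamental_commute i x : D x = 0 ->
  adj (E i) (adj (E (rev_ord i)) (corange D (p x))) =
  adj (E (rev_ord i)) (adj (E i) (corange D (p x))).
Proof.
move=> Dx; have c0 : corange D x = 0 by apply: val_inj; rewrite /= Dx.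
have := defect_comp i x; have := defect_comp (rev_ord i) x.
rewrite rev_ordK c0 !linear0 !add0r => <- <-; exact: adj_fundamental_kernel.
Qed.

End FundamentalOperators.

(** * Compressions of Gamma-unitaries *)

Lemma monomial_foldr (R : realType) (H : hilbertType R) m
    (T : 'I_m.+1 -> boundedOp H H) k x :
  monomial T k x = foldr (fun i y => iter (k (below_top i)) (T (below_top i)) y)
    (iter (k ord_max) (T ord_max) x) (enum 'I_m).
Proof.
have h s : (\big[(fun f g => f \o g)/id]_(i <- s) iter (k i) (T i)) x =
    foldr (fun i y => iter (k i) (T i) y) x s.
  by elim: s => [|i s IH]; rewrite ?big_nil // big_cons /= IH.
rewrite /monomial h [index_enum _]unlock -enumT enum_ordSr foldr_rcons.
by rewrite foldr_map.
Qed.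

Lemma foldr_iter_none (T : eqType) X (F : T -> X -> X) i s x : i \notin s ->
  foldr (fun j y => iter (j == i) (F j) y) x s = x.
Proof.
by elim: s => //= j s IH; rewrite inE negb_or eq_sym => /andP[/negPf -> /IH].
Qed.

Lemma foldr_iter_single (T : eqType) X (F : T -> X -> X) i s x : uniq s -> i \in s ->
  foldr (fun j y => iter (j == i) (F j) y) x s = F i x.
Proof.
elim: s => //= j s IH /andP[js us]; rewrite inE => /orP[/eqP ->|si].
  by rewrite eqxx /= foldr_iter_none.
by case: eqP => [e|_] /=; [rewrite e si in js|exact: IH].
Qed.

Section Monomials.
Variables (R : realType) (m : nat).

Lemma below_top_max (i : 'I_m) : (below_top i == ord_max) = false.
Proof. by rewrite -val_eqE /= ltn_eqF. Qed.

Variables (H : hilbertType R) (T : 'I_m.+1 -> boundedOp H H).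

Lemma monomial_top x :
  monomial T (fun j => j == ord_max) x = T ord_max x.
Proof.
rewrite monomial_foldr eqxx /=.
by elim: (enum 'I_m) => //= i s ->; rewrite below_top_max.
Qed.

Lemma monomial_below i x :
  monomial T (fun j => j == below_top i) x = T (below_top i) x.
Proof.
rewrite monomial_foldr eq_sym below_top_max /=.
exact: (foldr_iter_single (fun j => T (below_top j)) _ (enum_uniq _)
  (mem_enum _ i)).
Qed.

Lemma monomial_below_top i x :
  monomial T (fun j => (j == below_top i) + (j == ord_max))%N x =
  T (below_top i) (T ord_max x).
Proof.
rewrite monomial_foldr eqxx [ord_max == _]eq_sym below_top_max /=.
rewrite -[RHS](foldr_iter_single (fun j => T (below_top j)) _ (enum_uniq _)
  (mem_enum _ i)).
by elim: (enum 'I_m) => //= j s ->; rewrite below_top_max addn0.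
Qed.

End Monomials.

Section Dilation.
Variables (R : realType) (m : nat) (H K : hilbertType R).
Variable S : 'I_m.+1 -> boundedOp H H.
Variables (J0 : boundedOp H K) (V : 'I_m.+1 -> boundedOp K K).
Hypothesis dil : Gamma_isometric_dilation S J0 V.

Lemma isometric_nrm (H1 K1 : hilbertType R) (A : boundedOp H1 K1) :
  isometric A -> forall x, nrm (A x) = nrm x.
Proof. by move=> h x; rewrite /nrm h. Qed.

(** The two isometries are merged into one, J, whose range need not be invariant
    under U; of the dilation there remain the moments S_i and S_i S_n. *)
Lemma Gamma_unitary_dilation :
  exists (L : hilbertType R) (J : H -> L) (U : 'I_m.+1 -> boundedOp L L),
  [/\ linear J, forall x, nrm (J x) = nrm x, Gamma_unitary U,
    forall i x y, hdot (U i (J x)) (J y) = hdot (S i x) y &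
    forall i x y, hdot (U (below_top i) (U ord_max (J x))) (J y) =
      hdot (S (below_top i) (S ord_max x)) y].
Proof.
have [J0i [L [J1 [U [J1i UG J1V]]]] hS] := dil.
pose J x := J1 (J0 x); exists L, J, U.
have J1d := isometric_dot (linearP J1) (isometric_nrm J1i).
have compr f g k x y :
    (forall z, monomial V k z = f z) -> (forall z, monomial S k z = g z) ->
    hdot (J1 (f (J0 x))) (J y) = hdot (g x) y.
  move=> hf hg; rewrite J1d -hg -hS hf.
  by rewrite (adjoint_sym (adjP J0)).
split=> //.
- by move=> a x y; rewrite /J !linearP.
- by move=> x; rewrite /J !isometric_nrm.
- move=> i x y; rewrite -J1V.
  have [->|[j ->]] : i = ord_max \/ exists j, i = below_top j.
  - case: (unliftP ord_max i) => [j ->|->]; last by left.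
    by right; exists j; apply: val_inj; rewrite /= /bump leqNgt ltn_ord.
  - exact: compr (monomial_top V) (monomial_top S).
  - exact: compr (monomial_below V j) (monomial_below S j).
move=> i x y; rewrite -!J1V.
exact: (compr (fun z => V _ (V _ z)) (fun z => S _ (S _ z)) _ _ _
  (monomial_below_top V i) (monomial_below_top S i)).
Qed.

End Dilation.

Lemma identity_op (R : realType) (L : hilbertType R) :
  exists I : boundedOp L L, forall x, I x = x.
Proof.
have lI : linear (fun x : L => x) by [].
have cI : continuous (fun x : L => x) by move=> x.
pose I : boundedOp L L := HB.pack (fun x : L => x)
  (GRing.isLinear.Build _ _ _ _ _ lI) (isContinuous.Build _ _ _ cI).
by exists I.
Qed.

Section DilationOfFundamentalOperators.
Variables (R : realType) (m : nat) (H : hilbertType R) (S : 'I_m.+1 -> boundedOp H H).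
Variable D : boundedOp H H.
Hypothesis hD : is_defect (S ord_max) D.
Variable E : 'I_m -> boundedOp (defect_space D) (defect_space D).
Hypothesis hE : fundamental_operators S E.
Variables (L : hilbertType R) (J : H -> L) (U : 'I_m.+1 -> boundedOp L L).
Hypotheses (Jl : linear J) (Jn : forall x, nrm (J x) = nrm x) (UG : Gamma_unitary U).
Hypothesis compr : forall i x y, hdot (U i (J x)) (J y) = hdot (S i x) y.
Hypothesis compr2 : forall i x y, hdot (U (below_top i) (U ord_max (J x))) (J y) =
  hdot (S (below_top i) (S ord_max x)) y.

(** Since J^* U_n J = S_n, this is (1 - P) U_n J for the projection P onto the
    range of J. *)
Let W x := U ord_max (J x) - J (S ord_max x).

(** The isometry maps D x to W x.  Since U_n is unitary,
    |W x|^2 = |x|^2 - |S_n x|^2 = |D x|^2; and the compression W^* U_i W is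
    S_i - S_(n-i)^* S_n, because U_n^* U_i = U_(n-i)^*. *)
Lemma fundamental_dilation : exists2 Theta : boundedOp (defect_space D) L,
  isometric Theta & forall i u, adj Theta (U (below_top i) (Theta u)) = E i u.
Proof.
have Jd := isometric_dot Jl Jn.
have Udot x y : hdot (U ord_max x) (U ord_max y) = hdot x y.
  by rewrite adjP (Gamma_unitary_top UG).
have Wl : linear W.
  by move=> a x y; rewrite /W !linearP !Jl linearP scalerBr opprD addrACA.
have WD x : nrm (W x) = nrm (D x).
  apply/eqP; rewrite -(eqrXn2 (n := 2)) ?nrm_ge0 // (nrm_defect hD); apply/eqP.
  rewrite /W nrmB_sqr -rdotxx {1}/rdot Udot -/(rdot _ _) rdotxx !Jn.
  by rewrite /rdot compr -/(rdot _ _) rdotxx; ring.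
have Ul k : linear (U k) by exact: linearP.
have key i x y : hdot (U (below_top i) (W x)) (W y) =
    hdot (S (below_top i) x - adj (S (below_top (rev_ord i))) (S ord_max x)) y.
  (* J^* U_i W = S_i S_n - S_i S_n: this is where moments of degree two enter *)
  have orth z : hdot (U (below_top i) (W x)) (J z) = 0.
    by rewrite /W (linB (Ul _)) dotBl compr2 compr subrr.
  rewrite {2}/W dotBr orth subr0 /W (linB (Ul _)) !dotBl UG.1.1 Udot compr.
  congr (_ - _); rewrite adjP -[in adj (U (below_top i))](rev_ordK i).
  rewrite (Gamma_unitary_below UG) dotC compr -dotC.
  by rewrite (adjoint_sym (adjP _)).
have [Th Thi ThW] := isometry_extension Wl WD.
exists Th => // i; apply: corange_ext => [||x].
- apply: bounded_op_comp; last exact: adj_bounded.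
  by apply: (bounded_op_comp (boundedOp_bounded Th)); exact: boundedOp_bounded.
- exact: boundedOp_bounded.
apply: (defect_inj hD); rewrite -hE; apply: rdot_inj => y.
rewrite -(adjoint_rdot (defect_selfadjoint hD)) ThW.
rewrite -[LHS]/(rdot (corange D y) (adj Th (U (below_top i) (W x)))).
by rewrite -(adjoint_rdot (adjP Th)) ThW rdotC [RHS]rdotC /rdot key.
Qed.

End DilationOfFundamentalOperators.

Unset Implicit Arguments.
Set Strict Implicit.
Local Close Scope complex_scope.

(* n = m.+1 *)
Theorem theorem2p7 (R : realType) (m : nat) (hn : (2 <= m.+1)%N)
    (H : hilbertType R) (S : 'I_m.+1 -> boundedOp H H)
    (hS : Gamma_contraction S)
    (D : boundedOp H H) (hD : is_defect (S ord_max) D)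
    (E : 'I_m -> boundedOp (defect_space D) (defect_space D))
    (hE : fundamental_operators S E)
    (hdil : exists (K : hilbertType R) (J : boundedOp H K)
       (V : 'I_m.+1 -> boundedOp K K), Gamma_isometric_dilation S J V) :
  [/\ exists (Ht : hilbertType R) (Theta : boundedOp (defect_space D) Ht)
        (St : 'I_m -> boundedOp Ht Ht),
        let gSt := fun i : 'I_m => scale_op (gamma R m.+1 i.+1) (St i) in
        [/\ isometric Theta,
            forall (i : 'I_m) x, gamma R m.+1 i.+1 *: E i x = adj Theta (gSt i (Theta x)),
            commuting gSt,
            forall i : 'I_m, subnormal_op (gSt i) &
            exists (K : hilbertType R) (J : boundedOp Ht K)
              (U : 'I_m -> boundedOp K K),
              let gU := fun i : 'I_m => scale_op (gamma R m.+1 i.+1) (U i) in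
              [/\ isometric J,
                  commuting_normal gU,
                  forall (i : 'I_m) x, J (gSt i x) = gU i (J x) &
                  taylor_spectrum gU `<=` @Gamma R m]],
      forall (i : 'I_m) x, D x = 0 ->
        adj (E i) (corange D (S (below_top i) x)) -
        adj (E (rev_ord i)) (corange D (S (below_top (rev_ord i)) x)) = 0 &
      forall (i : 'I_m) x, D x = 0 ->
        adj (E i) (adj (E (rev_ord i)) (corange D (S ord_max x))) -
        adj (E (rev_ord i)) (adj (E i) (corange D (S ord_max x))) = 0].
Proof.
have [Sc _] := hS.
have [K [J0 [V dil]]] := hdil.
have [L [J [U [Jl Jn UG compr compr2]]]] := Gamma_unitary_dilation dil.
have [Th Thi ThE] := fundamental_dilation hD hE Jl Jn UG compr compr2.
have [gcn gsp] := Gamma_unitary_scaled_spectrum UG.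
have [I hI] := identity_op L.
split.
- exists L, Th, (fun i => U (below_top i)) => /=; split => //.
  + move=> i x; rewrite -ThE; have [al _] := adj_bounded Th.
    by rewrite -(linZ al).
  + exact: gcn.1.
  + move=> i; exists L, I, (scale_op (gamma R m.+1 i.+1) (U (below_top i))).
    by split=> [x||x]; rewrite ?hI //; exact: gcn.2.
  + by exists L, I, (fun i => U (below_top i)); split=> // [x|i x]; rewrite !hI.
- by move=> i x Dx; rewrite (adj_fundamental_kernel Sc hD hE) // subrr.
- by move=> i x Dx; rewrite (adj_fundamental_commute Sc hD hE) // subrr.
Qed.
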